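(* Let $\alpha\in(0,2)$, and for $n\in\mathbb Z$ let $\mu_n(x)=\dfrac{(ix-1)^n}{(ix+1)^{n+1}}$, $x\in\mathbb R$. Then, for every $x\in\mathbb R$, $$ (-\Delta)^{\alpha/2}\mu_n(x)= \begin{cases} \dfrac{\Gamma(1+\alpha)}{(ix+1)^{1+\alpha}}\;{}_2F_1\!\left(-n,1+\alpha;1;\dfrac{2}{ix+1}\right), & n=0,1,2,\ldots,\\[1em] -\dfrac{\Gamma(1+\alpha)}{(-ix+1)^{1+\alpha}}\;{}_2F_1\!\left(1+n,1+\alpha;1;\dfrac{2}{-ix+1}\right), & n=-1,-2,-3,\ldots \end{cases} $$ Moreover, the expression for $n=0$ reduces to $$(-\Delta)^{\alpha/2}\mu_0(x)=\frac{\Gamma(1+\alpha)}{(ix+1)^{1+\alpha}}.$$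
   Context: For $\alpha\in(0,2)$ the one-dimensional fractional Laplacian of a (possibly complex-valued) function $u$ on $\mathbb R$ is $$(-\Delta)^{\alpha/2}u(x)=c_\alpha\int_{-\infty}^\infty\frac{u(x)-u(x+y)}{|y|^{1+\alpha}}\,dy,\qquad c_\alpha=\alpha\,\frac{2^{\alpha-1}\Gamma(1/2+\alpha/2)}{\sqrt\pi\,\Gamma(1-\alpha/2)},$$ the integral being understood in the principal value sense at $y=0$; equivalently, for the functions considered here, $(-\Delta)^{\alpha/2}u(x)=\frac{c_\alpha}{\alpha}\int_0^\infty\frac{u'(x-y)-u'(x+y)}{y^\alpha}\,dy$. Complex powers are taken with the principal branch of the logarithm ($-\pi<\arg\le\pi$). The Gaussian hypergeometric function is ${}_2F_1(a,b;c;z)=\sum_{k=0}^\infty\frac{(a)_k(b)_k}{(c)_k}\frac{z^k}{k!}$, where $(w)_0=1$ and $(w)_k=w(w+1)\cdots(w+k-1)$ for $k\ge1$. When $a$ is a nonpositive integer the sum is finite (terms with $k>-a$ vanish), and it is then defined by this finite sum for all $z\in\mathbb C$. *)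

(* Defs.v *)
From HB Require Import structures.
From mathcomp Require Import all_boot all_order all_algebra.
From mathcomp Require Import all_classical all_reals all_analysis.
From mathcomp Require Import complex.
Set Implicit Arguments.
Unset Strict Implicit.
Unset Printing Implicit Defensive.
Import Order.TTheory GRing.Theory Num.Theory.
Import numFieldNormedType.Exports.
Local Open Scope classical_set_scope.
Local Open Scope ring_scope.
Local Open Scope complex_scope.

Local Notation Re := complex.Re.
Local Notation Im := complex.Im.

Section Defs.
Context {R : realType}.
Local Notation C := R[i].
Local Notation leb := (@lebesgue_measure R).

(* Euler's integral, which represents the Gamma function for s > 0 only; all
   the arguments it is used at are positive. *)
Definition Gamma (s : R) : R :=
  \int[leb]_(t in `]0, +oo[) (t `^ (s - 1) * expR (- t)).

Definition cexp (z : C) : C :=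
  (expR (Re z))%:C * (cos (Im z) +i* sin (Im z)).

Definition cabs (z : C) : R := Num.sqrt (Re z ^+ 2 + Im z ^+ 2).

(* Values in ]-pi, pi] for z != 0. *)
Definition carg (z : C) : R :=
  let t := acos (Re z / cabs z) in if 0 <= Im z then t else - t.

Definition cLog (z : C) : C := ln (cabs z) +i* carg z.

(* Principal branch; meaningful for z != 0. *)
Definition cpow (z w : C) : C := cexp (w * cLog z).

Definition pochhammer (w : C) (k : nat) : C := \prod_(i < k) (w + i%:R).

Definition hyp2F1_term (a b c z : C) (k : nat) : C :=
  pochhammer a k * pochhammer b k / pochhammer c k * (z ^+ k / k`!%:R).

(* The complex series is summed componentwise.  If a is a nonpositive integer,
   this is the terminating sum for every z: see hyp2F1_terminating. *)
Definition hyp2F1 (a b c z : C) : C :=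
  limn (series (fun k => Re (hyp2F1_term a b c z k))) +i*
  limn (series (fun k => Im (hyp2F1_term a b c z k))).

(* Principal value at y = 0 of an integral over the real line. *)
Definition pv_trunc (g : R -> R) (e : R) : R :=
  \int[leb]_(y in [set y | e < `|y|]) g y.

Definition pv_exists (g : R -> R) : Prop :=
  (forall e : R, 0 < e ->
     leb.-integrable [set y | e < `|y|] (EFin \o g)) /\
  cvg (pv_trunc g e @[e --> 0^'+]).

Definition pv_integral (g : R -> R) : R := lim (pv_trunc g e @[e --> 0^'+]).

Definition frac_const (alpha : R) : R :=
  alpha * (2 `^ (alpha - 1) * Gamma (1 / 2 + alpha / 2)
           / (Num.sqrt pi * Gamma (1 - alpha / 2))).

Definition frac_integrand (alpha : R) (u : R -> C) (x y : R) : C :=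
  (u x - u (x + y)) / (`|y| `^ (1 + alpha))%:C.

Definition frac_laplacian_exists (alpha : R) (u : R -> C) (x : R) : Prop :=
  pv_exists (fun y => Re (frac_integrand alpha u x y)) /\
  pv_exists (fun y => Im (frac_integrand alpha u x y)).

(* (-Delta)^(alpha/2) u (x), meaningful when frac_laplacian_exists alpha u x. *)
Definition frac_laplacian (alpha : R) (u : R -> C) (x : R) : C :=
  (frac_const alpha)%:C *
  (pv_integral (fun y => Re (frac_integrand alpha u x y)) +i*
   pv_integral (fun y => Im (frac_integrand alpha u x y))).

Definition mu_fun (n : int) (x : R) : C :=
  ('i%C * x%:C - 1) ^ n / ('i%C * x%:C + 1) ^ (n + 1).

End Defs.

Lemma pochhammer_eq0 (R : realType) (m k : nat) :
  (m < k)%N -> pochhammer (- m%:R : R[i]) k = 0.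
Proof.
move=> mk; rewrite /pochhammer (bigD1 (Ordinal mk)) //=.
by rewrite addNr mul0r.
Qed.

Lemma hyp2F1_terminating (R : realType) (m : nat) (b c z : R[i]) :
  hyp2F1 (- m%:R) b c z = \sum_(k < m.+1) hyp2F1_term (- m%:R) b c z k.
Proof.
pose t := hyp2F1_term (- m%:R) b c z.
have t0 k : (m < k)%N -> t k = 0.
  by move=> mk; rewrite /t /hyp2F1_term pochhammer_eq0// !mul0r.
have ReD (x y : R[i]) : Re (x + y) = Re x + Re y by case: x y => [? ?] [].
have ImD (x y : R[i]) : Im (x + y) = Im x + Im y by case: x y => [? ?] [].
have fin (f : R[i] -> R) : f 0 = 0 -> {morph f : x y / x + y} ->
    limn (series (f \o t)) = f (\sum_(k < m.+1) t k).
  move=> f0 fD; apply/lim_near_cst => //; near=> n.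
  have mn : (m.+1 <= n)%N by near: n; exact: nbhs_infty_ge.
  rewrite /series/= (big_cat_nat _ mn)//= [X in _ + X]big1_seq ?addr0; last first.
    move=> k /andP[_]; rewrite mem_index_iota => /andP[mk _].
    by rewrite t0.
  by rewrite big_mkord (big_morph f fD f0).
rewrite /hyp2F1 (fin (@complex.Re R))// (fin (@complex.Im R))//.
by case: (\sum_(_ < _) _).
Unshelve. all: by end_near. Qed.

(* Main.v *)
Require Import Defs.
From HB Require Import structures.
From mathcomp Require Import all_boot all_order all_algebra.
From mathcomp Require Import all_classical all_reals all_analysis.
From mathcomp Require Import complex measurable_realfun ring lra.
Set Implicit Arguments.
Unset Strict Implicit.
Unset Printing Implicit Defensive.
Import Order.TTheory GRing.Theory Num.Theory.
Import numFieldNormedType.Exports.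
Local Open Scope classical_set_scope.
Local Open Scope ring_scope.

(** Write [s = 1 + i x].  For [n >= 0] the binomial theorem expands [mu_n] in powers
    [s^-(k+1)], so that [mu_n(x)] is the Laplace transform at [s] of the real weight
    [w(t) = sum_k C(n,k) (-2)^k t^k e^-t / k!] (a Laguerre function, with [e^(-st)]
    split as [e^-t e^(-ixt)]); for [n < 0], [mu_n(x) = - mu_(-1-n)(-x)].
    By Fubini, the fractional Laplacian acts on such a superposition of
    exponentials as multiplication of the weight by [t^alpha], the symbol being
    [2 c_alpha int_0^oo (1 - cos (t y)) y^(-1-alpha) dy = t^alpha].
    The Laplace transform of [t^(k+alpha) e^-t] is
    [Gamma(k+1+alpha) s^-(k+1+alpha)], and summing over [k] gives the terminating
    hypergeometric series.

    The value of the symbol is found by integrating it against [e^-t], which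
    gives [Gamma(alpha/2) Gamma(1-alpha/2) / 2], and by the duplication formula. *)

(** * Change of variables *)

(** All analysis is done on real integrals over the open half-line. Complex values enter only
    through the phase in [cos (x * t + phi)]: [phi = 0] gives the real part of e^(-ixt) and
    [phi = - (pi / 2)] gives minus its imaginary part. One phase replaces a sine and a cosine
    transform because differentiation in [x] merely shifts it by [pi / 2].

    The obstacle is the principal value. For [alpha >= 1] the integrand is in general not absolutely
    integrable at [y = 0], so Fubini cannot be applied to it. Adding its values at [y] and [- y]
    produces the kernel 1 - cos (t y), which is nonnegative and O(y^2): divided by y^(1+alpha) it is
    integrable at 0 because [alpha < 2] and at infinity because [0 < alpha]. Fubini is applied to
    this folded integrand, whose tail integrals converge to the full one. *)

Section substitution.
Context {R : realType}.
Local Notation leb := (@lebesgue_measure R).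
Variables (F f H : R -> R) (D E : set R) (a b : R^nat).
Hypothesis (Do : open D) (a_ni : nonincreasing_seq a) (b_nd : nondecreasing_seq b).
Hypothesis ab : forall n, a n <= b n.
Hypothesis DE : D = \bigcup_n `[a n, b n]%classic.
Hypothesis dF : forall x, D x -> is_derive x 1 F (f x).
Hypothesis cf : forall x, D x -> {for x, continuous f}.
Hypothesis f0 : forall x, D x -> 0 <= f x.
Hypothesis incF : {in D &, {homo F : x y / x < y}}.
Hypothesis FDE : forall x, D x -> E (F x).
Hypothesis HED : forall y, E y -> D (H y) /\ F (H y) = y.

Let abD n x : x \in `[a n, b n] -> D x.
Proof. by move=> xab; rewrite DE; exists n. Qed.

Let DerF x : D x -> (derive1 F) x = f x.
Proof. by move=> Dx; have [_ <-] := dF Dx; rewrite derive1E. Qed.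

Let cF x : D x -> {for x, continuous F}.
Proof.
by move=> /dF Fx; apply/differentiable_continuous/derivable1_diffP; case: Fx.
Qed.

Let cDerF x : D x -> {for x, continuous (derive1 F)}.
Proof.
move=> Dx; rewrite /prop_for /continuous_at DerF//.
have : f z @[z --> x] --> f x by exact: cf.
apply: cvg_trans; apply: near_eq_cvg.
near=> z; apply/esym/DerF; near: z.
exact: (open_nbhs_nbhs (conj Do Dx)).
Unshelve. all: by end_near. Qed.

Let leF x y : D x -> D y -> x <= y -> F x <= F y.
Proof.
move=> Dx Dy; rewrite le_eqVlt => /predU1P[->//|xy].
by rewrite ltW// incF ?inE.
Qed.

Let FabE n y : y \in `[F (a n), F (b n)] -> E y.
Proof.
have Da : D (a n) by apply: (@abD n); rewrite in_itv/= lexx ab.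
have Db : D (b n) by apply: (@abD n); rewrite in_itv/= lexx ab.
move=> yF.
have [|||c cab <-] := @IVT R F (a n) (b n) y.
- exact: ab.
- by apply: continuous_in_subspaceT => x; rewrite inE/= => /abD/cF.
- by move: yF; rewrite in_itv/= (min_idPl (leF Da Db (ab n)))
     (max_idPr (leF Da Db (ab n))).
- exact/FDE/(@abD n).
Qed.

(** One inclusion is the intermediate value theorem, through [FabE]; the other takes the preimage
    [H y], finds an interval that contains it, and uses monotonicity of [F]. *)
Let EU : E = \bigcup_n `[F (a n), F (b n)]%classic.
Proof.
apply/seteqP; split=> [y /HED[]|y [n _] /FabE//].
rewrite {1}DE => -[n _ /=] Hab <-; exists n => //=.
move: (Hab); rewrite !in_itv/= => /andP[aH Hb].
by rewrite !leF//; apply: (@abD n); rewrite // in_itv/= lexx ab.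
Qed.

Let step (G : R -> R) n : (forall y, E y -> {for y, continuous G}) ->
  (\int[leb]_(y in `[F (a n), F (b n)]) (G y)%:E =
   \int[leb]_(x in `[a n, b n]) (G (F x) * f x)%:E)%E.
Proof.
move=> cG.
have Da : D (a n) by apply: (@abD n); rewrite in_itv/= lexx ab.
have Db : D (b n) by apply: (@abD n); rewrite in_itv/= lexx ab.
rewrite integration_by_substitution_increasing//.
- by apply: eq_integral => x; rewrite inE => /abD Dx /=; rewrite -DerF.
- by move=> x y /abD Dx /abD Dy; apply: incF; rewrite inE.
- by move=> x /subset_itv_oo_cc /abD /cDerF.
- by apply/cvg_ex; exists ((derive1 F) (a n)); exact/cvg_at_right_filter/cDerF.
- by apply/cvg_ex; exists ((derive1 F) (b n)); exact/cvg_at_left_filter/cDerF.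
- split; [|exact/cvg_at_right_filter/cF|exact/cvg_at_left_filter/cF].
  by move=> x /subset_itv_oo_cc /abD /dF[].
- by apply: continuous_in_subspaceT => x; rewrite inE/= => /FabE /cG.
Qed.

(** On each [[a n, b n]] this is the substitution rule for compact intervals. The intervals and
    their images increase to [D] and [E], so monotone convergence applies on both sides. *)
Let ge0_subst (G : R -> R) : (forall y, E y -> {for y, continuous G}) ->
  (forall y, E y -> 0 <= G y) ->
  (\int[leb]_(y in E) (G y)%:E = \int[leb]_(x in D) (G (F x) * f x)%:E)%E.
Proof.
move=> cG G0.
have aD n : D (a n) by apply: (@abD n); rewrite in_itv/= lexx ab.
have bD n : D (b n) by apply: (@abD n); rewrite in_itv/= lexx ab.
have cv1 : (\int[leb]_(y in `[F (a n), F (b n)]) (G y)%:E @[n --> \oo] -->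
    \int[leb]_(y in E) (G y)%:E)%E.
  rewrite EU; apply: ge0_nondecreasing_set_cvg_integral => //.
  - move=> m n mn; apply/subsetPset/subset_itv; rewrite bnd_simp leF//.
      exact: a_ni.
    exact: b_nd.
  - move=> n; apply/measurable_EFinP; apply: subspace_continuous_measurable_fun => //.
    by apply: continuous_in_subspaceT => x; rewrite inE/= => /FabE /cG.
  - by move=> n y /FabE /G0; rewrite lee_fin.
have cv2 : (\int[leb]_(x in `[a n, b n]) (G (F x) * f x)%:E @[n --> \oo] -->
    \int[leb]_(x in D) (G (F x) * f x)%:E)%E.
  rewrite DE; apply: ge0_nondecreasing_set_cvg_integral => //.
  - move=> m n mn; apply/subsetPset/subset_itv; rewrite bnd_simp.
      exact: a_ni.
    exact: b_nd.
  - move=> n; apply/measurable_EFinP; apply: subspace_continuous_measurable_fun => //.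
    apply: continuous_in_subspaceT => x; rewrite inE/= => /abD Dx.
    apply: continuousM; last exact: cf.
    by apply: continuous_comp; [exact: cF|exact/cG/FDE].
  - by move=> n y /abD Dy; rewrite lee_fin mulr_ge0// ?f0//; exact/G0/FDE.
rewrite -(cvg_lim _ cv1)// -(cvg_lim _ cv2)//.
by under eq_fun do rewrite step//.
Qed.


(** Since [f] is nonnegative, multiplying by it commutes with taking positive and negative parts,
    which reduces the claim to [ge0_subst]. The equality is one of extended reals, so that it can
    later serve to prove integrability. *)
Lemma integral_substitution (G : R -> R) :
  (forall y, E y -> {for y, continuous G}) ->
  (\int[leb]_(y in E) (G y)%:E = \int[leb]_(x in D) (G (F x) * f x)%:E)%E.
Proof.
move=> cG; rewrite integralE [RHS]integralE.
have cm (h : R -> R) (y : R) : {for y, continuous h} ->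
    {for y, continuous (fun z => Num.max (h z) 0)}.
  by move=> ch; apply: continuous_max => //; exact: cst_continuous.
congr (_ - _)%E.
- under eq_integral do rewrite funeposE -EFin_max.
  rewrite (@ge0_subst (fun y => Num.max (G y) 0)).
  + apply: eq_integral => x; rewrite inE => Dx.
    by rewrite funeposE -EFin_max maxr_pMl ?f0// mul0r.
  + by move=> y Ey; exact/cm/cG.
  + by move=> y _; rewrite le_max lexx orbT.
- under eq_integral do rewrite funenegE -EFinN -EFin_max.
  rewrite (@ge0_subst (fun y => Num.max (- G y) 0)).
  + apply: eq_integral => x; rewrite inE => Dx.
    by rewrite funenegE -EFinN -EFin_max maxr_pMl ?f0// mul0r mulNr.
  + by move=> y Ey; apply/cm/continuousN/cG.
  + by move=> y _; rewrite le_max lexx orbT.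
Qed.

End substitution.

Section substitution_instances.
Context {R : realType}.
Local Notation leb := (@lebesgue_measure R).
Local Notation P := (`]0, +oo[%classic : set R).

Lemma bigcup_itv_gt0 : P = \bigcup_n `[(n.+1%:R)^-1, n.+1%:R : R]%classic.
Proof.
apply/seteqP; split=> [x /=|x [n _]] /=; last first.
  by rewrite !in_itv/= andbT => /andP[nx _]; apply: lt_le_trans nx; rewrite invr_gt0.
rewrite in_itv/= andbT => x0.
(* An integer [n.+1] above both [x] and its inverse puts [x] between [n.+1%:R^-1] and [n.+1%:R]. *)
pose n := Num.truncn (x + x^-1).
have xn : x + x^-1 < n.+1%:R by rewrite truncnS_gt.
have xV0 : 0 < x^-1 by rewrite invr_gt0.
exists n => //=; rewrite in_itv/=; apply/andP; split.
  by rewrite invf_ple ?posrE// (le_trans _ (ltW xn))// lerDr ltW.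
by rewrite (le_trans _ (ltW xn))// lerDl ltW.
Qed.

Lemma bigcup_itv_real : [set: R] = \bigcup_n `[- n%:R, n%:R : R]%classic.
Proof.
apply/seteqP; split=> // x _; pose n := (Num.truncn `|x|).+1.
exists n => //=; rewrite in_itv/= -ler_norml ltW// truncnS_gt//.
Qed.

Lemma integral_substitution_gt0 (F f H G : R -> R) (E : set R) :
  (forall x : R, 0 < x -> is_derive x 1 F (f x)) ->
  (forall x : R, 0 < x -> {for x, continuous f}) ->
  (forall x : R, 0 < x -> 0 <= f x) ->
  (forall x y : R, 0 < x -> x < y -> F x < F y) ->
  (forall x : R, 0 < x -> E (F x)) -> (forall y, E y -> 0 < H y /\ F (H y) = y) ->
  (forall y, E y -> {for y, continuous G}) ->
  (\int[leb]_(y in E) (G y)%:E = \int[leb]_(x in P) (G (F x) * f x)%:E)%E.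
Proof.
move=> dF cf f0 incF FE HE cG.
have PE x : P x = (0 < x) by rewrite /= in_itv/= andbT.
apply: (@integral_substitution _ F f H _ _ (fun n => (n.+1%:R)^-1)
    (fun n => n.+1%:R)) => //.
- by move=> m n mn; rewrite lef_pV2 ?posrE// ler_nat.
- by move=> m n mn; rewrite ler_nat.
- move=> n; rewrite (@le_trans _ _ 1)// ?ler1n//.
  by rewrite invf_le1// ler1n.
- exact: bigcup_itv_gt0.
- by move=> x; rewrite PE; exact: dF.
- by move=> x; rewrite PE; exact: cf.
- by move=> x; rewrite PE; exact: f0.
- by move=> x y; rewrite !inE !PE => x0 _; exact: incF.
- by move=> x; rewrite PE; exact: FE.
- by move=> y /HE; rewrite PE.
Qed.

Lemma integral_substitutionT (F f H G : R -> R) (E : set R) :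
  (forall x : R, is_derive x 1 F (f x)) -> continuous f ->
  (forall x, 0 <= f x) -> {homo F : x y / x < y} ->
  (forall x, E (F x)) -> (forall y, E y -> F (H y) = y) ->
  (forall y, E y -> {for y, continuous G}) ->
  (\int[leb]_(y in E) (G y)%:E = \int[leb]_x (G (F x) * f x)%:E)%E.
Proof.
move=> dF cf f0 incF FE HE cG.
apply: (@integral_substitution _ F f H _ _ (fun n => - n%:R) (fun n => n%:R)) => //.
- exact: openT.
- by move=> m n mn; rewrite lerN2 ler_nat.
- by move=> m n mn; rewrite ler_nat.
- by move=> n; rewrite (@le_trans _ _ 0) ?oppr_le0.
- exact: bigcup_itv_real.
- by move=> x _; exact: cf.
- by move=> x y _ _; exact: incF.
- by move=> y Ey; split => //; exact: HE.
Qed.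

(** The exponent [q = 1] gives scaling, [q = s^-1] removes the singularity of the Gamma integrand at
    0, and [q = 2] passes between Gamma integrals and Gaussian-type ones. *)
Lemma integral_powR_substitution (c q : R) (G : R -> R) : 0 < c -> 0 < q ->
  (forall y : R, 0 < y -> {for y, continuous G}) ->
  (\int[leb]_(y in P) (G y)%:E =
   \int[leb]_(x in P) (G (c * x `^ q) * (c * (q * x `^ (q - 1))))%:E)%E.
Proof.
move=> c0 q0 cG.
have PE x : P x = (0 < x) by rewrite /= in_itv/= andbT.
apply: (@integral_substitution_gt0 _ _ (fun y => (y / c) `^ (q^-1))).
- move=> x x0; have := @is_derive1_powR _ q x x0 => dx.
  exact: (is_deriveZ c dx).
- move=> x x0; apply: continuousM; first exact: cst_continuous.
  apply: continuousM; first exact: cst_continuous.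
  apply/differentiable_continuous/derivable1_diffP.
  by apply: derivable_powR; rewrite in_itv/= andbT.
- by move=> x x0; rewrite !mulr_ge0 ?powR_ge0 ?ltW.
- move=> x y x0 xy; rewrite ltr_pM2l// gt0_ltr_powR ?nnegrE ?ltW//.
  exact: lt_trans xy.
- by move=> x x0; rewrite PE mulr_gt0// powR_gt0.
- move=> y; rewrite PE => y0; split; first by rewrite powR_gt0// divr_gt0.
  rewrite -powRrM mulVf ?gt_eqF// powRr1 ?ltW ?divr_gt0//.
  by rewrite mulrCA divff ?gt_eqF// mulr1.
- by move=> y; rewrite PE; exact: cG.
Qed.

Lemma integral_scaling (c : R) (G : R -> R) : 0 < c ->
  (forall y : R, 0 < y -> {for y, continuous G}) ->
  (\int[leb]_(y in P) (G y)%:E = \int[leb]_(x in P) (G (c * x) * c)%:E)%E.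
Proof.
move=> c0 cG; rewrite (integral_powR_substitution c0 (@ltr01 R) cG).
apply: eq_integral => x; rewrite inE/= in_itv/= andbT => x0.
by rewrite powRr1 ?ltW// subrr powRr0 !mulr1.
Qed.

End substitution_instances.

(** * Iterated integrals over the half-line *)

Ltac meas :=
  lazymatch goal with
  | |- measurable_fun _ (fun x => (@?f x + @?g x)%R) =>
      apply: (measurable_funD (f := f) (g := g)); meas
  | |- measurable_fun _ (fun x => (@?f x * @?g x)%R) =>
      apply: (measurable_funM (f := f) (g := g)); meas
  | |- measurable_fun _ (fun x => (- @?f x)%R) =>
      apply: (measurableT_comp (g := f) (@oppr_measurable _ _)); meas
  | |- measurable_fun _ (fun x => expR (@?f x)) =>
      apply: (measurableT_comp (g := f) (@measurable_expR _)); meas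
  | |- measurable_fun _ (fun x => cos (@?f x)) =>
      apply: (measurableT_comp (g := f)
        (continuous_measurable_fun (@continuous_cos _))); meas
  | |- measurable_fun _ (fun x => sin (@?f x)) =>
      apply: (measurableT_comp (g := f)
        (continuous_measurable_fun (@continuous_sin _))); meas
  | |- measurable_fun _ (fun x => (@?f x `^ _)%R) =>
      apply: (measurableT_comp (g := f) (@measurable_powR _ _)); meas
  | |- measurable_fun _ (fun x => (@?f x ^+ _)%R) =>
      apply: (measurable_funX (f := f)); meas
  | |- measurable_fun _ (fun x => `| @?f x |%R) =>
      apply: (measurableT_comp (g := f) (@normr_measurable _ _)); meas
  | |- measurable_fun _ (fun x => (@?f x)%:E) => apply/measurable_EFinP; meas
  | |- _ => first [exact: measurable_cst | exact: measurable_id |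
      exact: measurable_fst | exact: measurable_snd | done | idtac]
  end.


Section half_line.
Context {R : realType}.
Local Notation leb := (@lebesgue_measure R).
Local Notation P := (`]0, +oo[%classic : set R).

Lemma in_gt0 (x : R) : P x = (0 < x) :> Prop.
Proof. by rewrite /= in_itv/= andbT. Qed.

Lemma mem_gt0 (x : R) : (x \in P) = (0 < x).
Proof. by apply/idP/idP; rewrite inE in_gt0. Qed.

Lemma eq_integral_gt0 (f g : R -> \bar R) : (forall x, 0 < x -> f x = g x) ->
  (\int[leb]_(x in P) f x = \int[leb]_(x in P) g x)%E.
Proof. by move=> fg; apply: eq_integral => x; rewrite mem_gt0; exact: fg. Qed.

(** Extension by zero off the open quadrant: iterated integrals over half-lines become iterated
    integrals over the plane, where the theorems of Tonelli and Fubini are applied. *)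
Let restr2 (f : R * R -> \bar R) : R * R -> \bar R := f \_ (P `*` P).

Let restr2E f x y : restr2 f (x, y) =
  if (0 < x) && (0 < y) then f (x, y) else 0%E.
Proof.
rewrite /restr2 patchE; congr (if _ then _ else _).
by apply/idP/idP; rewrite inE/= !in_itv/= !andbT => /andP.
Qed.

Let mrestr2 f : measurable_fun setT f -> measurable_fun setT (restr2 f).
Proof.
move=> mf; apply/(measurable_restrictT f); first exact: measurableX.
exact: measurable_funTS.
Qed.

Let restr2_12 f :
  (\int[leb]_x \int[leb]_y restr2 f (x, y) =
   \int[leb]_(x in P) \int[leb]_(y in P) f (x, y))%E.
Proof.
rewrite [RHS]integral_mkcond; apply: eq_integral => x _.
rewrite patchE mem_gt0; case: ifPn => x0.
  rewrite [RHS]integral_mkcond; apply: eq_integral => y _.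
  by rewrite patchE mem_gt0 restr2E x0.
by apply: integral0_eq => y _; rewrite restr2E (negbTE x0).
Qed.

Let restr2_21 f :
  (\int[leb]_y \int[leb]_x restr2 f (x, y) =
   \int[leb]_(y in P) \int[leb]_(x in P) f (x, y))%E.
Proof.
rewrite [RHS]integral_mkcond; apply: eq_integral => x _.
rewrite patchE mem_gt0; case: ifPn => x0.
  rewrite [RHS]integral_mkcond; apply: eq_integral => y _.
  by rewrite patchE mem_gt0 restr2E x0 andbT.
by apply: integral0_eq => y _; rewrite restr2E (negbTE x0) andbF.
Qed.

Lemma tonelli_gt0 (f : R * R -> \bar R) : measurable_fun setT f ->
  (forall x y : R, 0 < x -> 0 < y -> (0 <= f (x, y))%E) ->
  (\int[leb]_(x in P) \int[leb]_(y in P) f (x, y) =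
   \int[leb]_(y in P) \int[leb]_(x in P) f (x, y))%E.
Proof.
move=> mf f0; rewrite -restr2_12 -restr2_21.
apply: (@fubini_tonelli _ _ _ _ R leb leb (restr2 f)); first exact: mrestr2.
move=> [x y]; rewrite restr2E; case: ifPn => // /andP[x0 y0]; exact: f0.
Qed.

(** Finiteness is tested with the first variable innermost, while integrability is concluded for the
    function of that first variable. In the application the first variable is the displacement [y],
    and integrating it out first gives the symbol explicitly. *)
Lemma fubini_gt0 (f : R * R -> \bar R) : measurable_fun setT f ->
  (\int[leb]_(y in P) \int[leb]_(x in P) `|f (x, y)| < +oo)%E ->
  leb.-integrable P (fun x => \int[leb]_(y in P) f (x, y))%E /\
  (\int[leb]_(x in P) \int[leb]_(y in P) f (x, y) =
   \int[leb]_(y in P) \int[leb]_(x in P) f (x, y))%E.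
Proof.
move=> mf fy.
have int2 : (leb \x leb)%E.-integrable setT (restr2 f).
  apply/integrable21ltyP; first exact: mrestr2.
  rewrite -(restr2_21 (abse \o f)) in fy.
  apply: le_lt_trans fy; rewrite le_eqVlt; apply/orP; left; apply/eqP.
  apply: eq_integral => y _; apply: eq_integral => x _.
  by rewrite !restr2E; case: ifPn => //; rewrite abse0.
split; last by rewrite -restr2_12 -restr2_21; exact: Fubini.
apply/integrable_mkcond => //.
have := integrable_fubini_F int2; apply: eq_integrable => // x _.
rewrite patchE mem_gt0 /fubini_F; case: ifPn => x0.
  rewrite [RHS]integral_mkcond; apply: eq_integral => y _.
  by rewrite patchE mem_gt0 restr2E x0.
by apply: integral0_eq => y _; rewrite restr2E (negbTE x0).
Qed.

End half_line.

(** * The Gamma integral at complex arguments *)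

Section gamma.
Context {R : realType}.
Local Notation leb := (@lebesgue_measure R).
Local Notation P := (`]0, +oo[%classic : set R).

Lemma integrable_oneDsqrV :
  leb.-integrable P (fun x => (1 + x ^+ 2)^-1%:E).
Proof.
have cV : continuous (fun x : R => (1 + x ^+ 2)^-1) by exact: continuous_oneDsqrV.
have mV : measurable_fun setT (fun x : R => (1 + x ^+ 2)^-1).
  exact: continuous_measurable_fun.
have V0 x : 0 <= (1 + x ^+ 2)^-1 :> R by rewrite invr_ge0 addr_ge0// sqr_ge0.
apply/integrableP; split; first by apply/measurable_EFinP/measurable_funTS.
under eq_integral do rewrite gee0_abs ?lee_fin//.
rewrite integral_itv_obnd_cbnd; last by apply/measurable_EFinP/measurable_funTS.
rewrite (@ge0_continuous_FTC2y _ _ (@atan R) 0 (pi / 2)) ?atan0 ?ltry//.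
- exact: continuous_subspaceT.
- exact: cvgy_atan.
- apply: cvg_at_right_filter; rewrite -[X in _ --> X]atan0.
  exact: continuous_atan.
- by move=> x _; rewrite derive1_atan.
Qed.

Lemma gamma_measurable (s : R) (D : set R) :
  measurable_fun D (fun t : R => (t `^ (s - 1) * expR (- t))%:E).
Proof. by apply: measurable_funTS; meas. Qed.

Lemma continuous_powR (s x : R) : 0 < x -> {for x, continuous (@powR R ^~ s)}.
Proof.
move=> x0; apply/differentiable_continuous/derivable1_diffP.
by apply: derivable_powR; rewrite in_itv/= andbT.
Qed.

(* The substitution [t = u^(1/s)] turns the Gamma integrand into
   [exp (- u^(1/s)) / s], which has no singularity at 0. *)
Let stretched_exp_le (s : R) : 0 < s -> exists C : R, 0 <= C /\
  forall u, 0 < u -> expR (- u `^ s^-1) <= C * (1 + u ^+ 2)^-1.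
Proof.
(* With z = u^(1/s) one has u^2 = z^(2s) <= (1 + z)^(2s) <= (1 + z)^(n+1) <= (n+1)! e^(1+z). Hence 1
   + u^2 <= 2 (n+1)! e e^z, which explains the constant. *)
move=> s0; pose n := Num.truncn (2 * s).
have n2s : 2 * s <= n.+1%:R by rewrite ltW// truncnS_gt.
exists (2 * n.+1`!%:R * expR 1); split; first by rewrite !mulr_ge0 ?expR_ge0.
move=> u u0; set z := u `^ s^-1.
have z0 : 0 < z by exact: powR_gt0.
have z1 : 1 <= 1 + z by rewrite lerDl ltW.
have e1 : (1 + z) ^+ n.+1 <= n.+1`!%:R * (expR 1 * expR z).
  rewrite -expRD -ler_pdivrMl ?ltr0n ?fact_gt0// mulrC.
  rewrite (le_trans _ (@expR_ge1Dxn _ (1 + z) n _))// ?lerDr//.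
  by rewrite (le_trans _ z1).
have e2 : (1 + z) `^ (2 * s) <= (1 + z) ^+ n.+1.
  by rewrite -powR_mulrn ?(le_trans _ z1)// ler_powR.
have e3 : 1 <= (1 + z) `^ (2 * s).
  by rewrite -[leLHS](powRr0 (1 + z)) ler_powR// mulr_ge0// ltW.
have e4 : u ^+ 2 <= (1 + z) `^ (2 * s).
  have -> : u ^+ 2 = z `^ (2 * s).
    by rewrite -powRrM mulrCA mulVf ?gt_eqF// mulr1 powR_mulrn// ltW.
  by apply: ge0_ler_powR; rewrite ?nnegrE ?mulr_ge0 ?ltW// ?ltrDr// addr_gt0.
rewrite expRN ler_pdivlMr; last by rewrite ltr_pwDl// sqr_ge0.
rewrite ler_pdivrMl ?expR_gt0//.
have : 1 + u ^+ 2 <= 2 * (n.+1`!%:R * (expR 1 * expR z)) by lra.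
by move=> /le_trans; apply; lra.
Qed.

Lemma gamma_integrable (s : R) : 0 < s ->
  leb.-integrable P (fun t => (t `^ (s - 1) * expR (- t))%:E).
Proof.
move=> s0; apply/integrableP; split; first exact: gamma_measurable.
rewrite (@eq_integral_gt0 _ _ (fun t => (t `^ (s - 1) * expR (- t))%:E)); last first.
  by move=> x x0; rewrite gee0_abs// lee_fin mulr_ge0 ?powR_ge0 ?expR_ge0.
have V0 : 0 < s^-1 by rewrite invr_gt0.
rewrite (integral_powR_substitution (@ltr01 R) V0); last first.
  move=> y y0; apply: continuousM; first exact: continuous_powR.
  apply: continuous_comp; [exact: continuousN|exact: continuous_expR].
rewrite (@eq_integral_gt0 _ _ (fun x => (s^-1 * expR (- x `^ s^-1))%:E)); last first.
  move=> x x0; rewrite !mul1r -powRrM; congr EFin.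
  have e : x `^ (s^-1 * (s - 1)) * x `^ (s^-1 - 1) = 1.
    rewrite -powRD; last by rewrite (gt_eqF x0) implybT.
    by rewrite (_ : _ + _ = 0) ?powRr0//; field; rewrite gt_eqF.
  by rewrite -[RHS]mulr1 -[X in _ = _ * X]e; ring.
have [C [C0 sC]] := stretched_exp_le s0.
have : leb.-integrable P (fun x => (s^-1 * C)%:E * ((1 + x ^+ 2)^-1)%:E)%E.
  by apply: integrableZl => //; exact: integrable_oneDsqrV.
move=> /integrableP[_]; apply: le_lt_trans.
apply: ge0_le_integral => //=.
- by move=> x _; rewrite lee_fin mulr_ge0 ?expR_ge0// ltW.
- by apply: measurable_funTS; meas.
- apply: measurableT_comp => //; apply: measurable_funTS; meas.
  exact: (continuous_measurable_fun (@continuous_oneDsqrV R)).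
- move=> x; rewrite in_itv/= andbT => x0; rewrite lee_fin ger0_norm; last first.
    by rewrite mulr_ge0 ?mulr_ge0 ?(ltW V0)// invr_ge0 addr_ge0// sqr_ge0.
  by rewrite -mulrA ler_pM2l// sC.
Qed.

Lemma EFin_Gamma (s : R) : 0 < s ->
  ((Gamma s)%:E = \int[leb]_(t in P) (t `^ (s - 1) * expR (- t))%:E)%E.
Proof.
move=> s0; rewrite /Gamma /Rintegral fineK//.
exact: (integrable_fin_num _ (gamma_integrable s0)).
Qed.

Lemma Gamma_gt0 (s : R) : 0 < s -> 0 < Gamma s.
Proof.
move=> s0; rewrite -lte_fin EFin_Gamma//.
(* A lower bound of the integrand on [1, 2]: there 0 <= ln t <= ln 2, so t^(s-1) >= 2^(-|s-1|)
   whatever the sign of s - 1, and e^-t >= e^-2. *)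
pose c := expR (- (`|s - 1| * ln 2)) * expR (- 2) : R.
have c0 : 0 < c by rewrite mulr_gt0 ?expR_gt0.
have : (0 < \int[leb]_(t in `[1%R, 2%R]) (cst c%:E t))%E.
  rewrite integral_cst//= lebesgue_measure_itv/= lte_fin ltr1n/= -EFinB -EFinM lte_fin.
  by rewrite mulr_gt0// subr_gt0 ltr1n.
move=> /lt_le_trans; apply.
apply: (@le_trans _ _ (\int[leb]_(t in `[1%R, 2%R]) (t `^ (s - 1) * expR (- t))%:E)%E).
  apply: ge0_le_integral => //=.
  - by move=> x _; rewrite lee_fin ltW.
  - exact: gamma_measurable.
  - move=> x; rewrite in_itv/= => /andP[x1 x2]; rewrite lee_fin.
    have x0 : 0 < x by exact: lt_le_trans x1.
    rewrite ler_pM ?expR_ge0// ?ler_expR ?lerN2//.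
    rewrite /powR gt_eqF// ler_expR.
    have l0 : 0 <= ln x by rewrite ln_ge0.
    have l2 : ln x <= ln 2 by rewrite ler_ln// posrE.
    rewrite lerNl -mulNr (le_trans (y := `|s - 1| * ln x))//.
      by rewrite ler_wpM2r// -normrN ler_norm.
    by rewrite ler_wpM2l.
apply: ge0_subset_integral => //.
- exact: gamma_measurable.
- by move=> x _; rewrite lee_fin mulr_ge0 ?powR_ge0 ?expR_ge0.
- by move=> x; rewrite in_gt0/= in_itv/= => /andP[x1 _]; exact: lt_le_trans x1.
Qed.

End gamma.

(** * The cosine transform of the Gamma density, with a phase *)

Section cosine_transform.
Context {R : realType}.
Local Notation leb := (@lebesgue_measure R).
Local Notation P := (`]0, +oo[%classic : set R).

Lemma integrable_mull (k : R) (f : R -> R) :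
  leb.-integrable P (fun t => (f t)%:E) ->
  leb.-integrable P (fun t => (k * f t)%:E).
Proof. by move=> intf; apply: (integrableZl _ k intf). Qed.

Lemma integrable_add (f g : R -> R) :
  leb.-integrable P (fun t => (f t)%:E) ->
  leb.-integrable P (fun t => (g t)%:E) ->
  leb.-integrable P (fun t => (f t + g t)%:E).
Proof. by move=> intf intg; apply: (integrableD _ intf intg). Qed.

Lemma integrable_sub (f g : R -> R) :
  leb.-integrable P (fun t => (f t)%:E) ->
  leb.-integrable P (fun t => (g t)%:E) ->
  leb.-integrable P (fun t => (f t - g t)%:E).
Proof. by move=> intf intg; apply: (integrableB _ intf intg). Qed.

Lemma is_derive_integral (f g : R -> R -> R) (G : R -> R) (a u v : R) :
  u < a < v -> (forall x : R, u < x < v -> leb.-integrable P (EFin \o f x)) ->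
  (forall x t : R, u < x < v -> 0 < t -> is_derive x 1 (f ^~ t) (g x t)) ->
  (forall t, 0 <= G t) -> leb.-integrable P (EFin \o G) ->
  (forall x t : R, u < x < v -> 0 < t -> `|g x t| <= G t) ->
  is_derive a 1 (fun x => \int[leb]_(t in P) f x t) (\int[leb]_(t in P) g a t).
Proof.
move=> uav intf df G0 intG gG.
have Iuv x : `]u, v[%classic x = (u < x < v) :> Prop by rewrite /= in_itv.
have Ia : `]u, v[%classic a by rewrite Iuv.
have d1f x t : u < x < v -> 0 < t -> partial1of2 f x t = g x t.
  by move=> xuv t0; rewrite partial1of2E; have [_ ->] := df x t xuv t0.
have intf' x : `]u, v[%classic x -> leb.-integrable P (EFin \o f x).
  by rewrite Iuv; exact: intf.
have df' x t : `]u, v[%classic x -> P t -> derivable (f ^~ t) x 1.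
  by rewrite Iuv in_gt0 => xuv t0; case: (df x t xuv t0).
have hG x t : `]u, v[%classic x -> P t -> `|partial1of2 f x t| <= G t.
  by rewrite Iuv in_gt0 => xuv t0; rewrite d1f// gG.
have mP : measurable P by [].
split.
  exact: (@derivable_under_integral _ _ _ leb f P mP a u v Ia intf' df' G G0 intG hG).
rewrite -derive1E.
rewrite (@differentiation_under_integral _ _ _ leb f P mP a u v Ia intf' df' G G0 intG hG).
by apply: eq_Rintegral => t; rewrite mem_gt0 => /(d1f _ _ uav).
Qed.

Lemma integrable_mulr_cos (w : R -> R) (x phi : R) : measurable_fun setT w ->
  leb.-integrable P (EFin \o w) ->
  leb.-integrable P (fun t => (w t * cos (x * t + phi))%:E).
Proof.
move=> mw; apply: le_integrable => //; first by apply: measurable_funTS; meas.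
move=> t _; rewrite lee_fin normrM ler_piMr// ler_norml cos_geN1 cos_le1//.
Qed.

(** The real part of e^(i phi) times the Laplace transform of t^(p-1) at 1 - i x; the closed form
    [gamma_cosE] is accordingly the real part of e^(i phi) Gamma(p) (1 - i x)^(-p). *)
Definition gamma_cos (p phi x : R) : R :=
  \int[leb]_(t in P) (t `^ (p - 1) * expR (- t) * cos (x * t + phi)).

Let gamma_cos_integrable (p phi x : R) : 0 < p -> leb.-integrable P
  (fun t => (t `^ (p - 1) * expR (- t) * cos (x * t + phi))%:E).
Proof.
move=> p0; apply: integrable_mulr_cos; last exact: gamma_integrable.
by meas.
Qed.

Lemma is_derive_gamma_cos (p phi x : R) : 0 < p ->
  is_derive x 1 (gamma_cos p phi) (gamma_cos (p + 1) (phi + pi / 2) x).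
Proof.
move=> p0.
pose f (x t : R) := t `^ (p - 1) * expR (- t) * cos (x * t + phi).
pose g (x t : R) := t `^ (p + 1 - 1) * expR (- t) * cos (x * t + (phi + pi / 2)).
have df (a t : R) : 0 < t -> is_derive a 1 (f ^~ t) (g a t).
  move=> t0; apply: is_derive_eq.
  rewrite /g /GRing.scale/= addrA cosDpihalf.
  have -> : t `^ (p + 1 - 1) = t `^ (p - 1) * t.
    by rewrite -{3}(powRr1 (ltW t0)) -powRD ?(gt_eqF t0) ?implybT// addrAC.
  by ring.
apply: (@is_derive_integral f g (fun t => t `^ (p + 1 - 1) * expR (- t))
  x (x - 1) (x + 1)) => //.
- by lra.
- by move=> a _; exact: gamma_cos_integrable.
- by move=> t; rewrite mulr_ge0 ?powR_ge0 ?expR_ge0.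
- by apply: gamma_integrable; rewrite addr_gt0.
- move=> a t _ t0; rewrite normrM ger0_norm ?mulr_ge0 ?powR_ge0 ?expR_ge0//.
  by rewrite ler_piMr ?mulr_ge0 ?powR_ge0 ?expR_ge0// ler_norml cos_geN1 cos_le1.
Qed.

Lemma gamma_scaled_integrable (p c : R) : 0 < p -> 0 < c ->
  leb.-integrable P (fun t => (t `^ (p - 1) * expR (- (c * t)))%:E).
Proof.
move=> p0 c0.
have e1 (t : R) : 0 < t -> t `^ (p - 1) * expR (- (c * t)) =
    (c `^ (p - 1))^-1 * c^-1 * ((c * t) `^ (p - 1) * expR (- (c * t)) * c).
  move=> t0; rewrite powRM ?ltW//.
  have : c `^ (p - 1) != 0 by rewrite gt_eqF// powR_gt0.
  by move: (c `^ _) => A A0; field; rewrite A0 gt_eqF.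
apply: (@eq_integrable _ _ _ leb _ _ (fun t => ((c `^ (p - 1))^-1 * c^-1)%:E *
    ((c * t) `^ (p - 1) * expR (- (c * t)) * c)%:E)%E) => //.
  by move=> t; rewrite mem_gt0 => t0; rewrite -EFinM -e1.
apply: integrableZl => //; apply/integrableP; split.
  by apply: measurable_funTS; meas.
have : (\int[leb]_(t in P) (t `^ (p - 1) * expR (- t))%:E < +oo)%E.
  by rewrite -EFin_Gamma// ltry.
rewrite (integral_scaling c0); last first.
  move=> y y0; apply: continuousM; first exact: continuous_powR.
  by apply: continuous_comp; [exact: continuousN|exact: continuous_expR].
apply: le_lt_trans; rewrite le_eqVlt; apply/orP; left; apply/eqP.
apply: eq_integral_gt0 => t t0; rewrite gee0_abs// lee_fin.
by rewrite !mulr_ge0 ?powR_ge0 ?expR_ge0// ltW.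
Qed.

(* The integral does not change under [t := a t]; differentiating the
   rescaled integrand at [a = 1] gives the relation. *)
Let recurrence (p phi x : R) : 0 < p ->
  p * gamma_cos p phi x =
  gamma_cos (p + 1) phi x - x * gamma_cos (p + 1) (phi + pi / 2) x.
Proof.
move=> p0.
pose f (a t : R) := a `^ p * (t `^ (p - 1) * expR (- (a * t)) * cos (a * t * x + phi)).
pose g (a t : R) := p * a `^ (p - 1) *
    (t `^ (p - 1) * expR (- (a * t)) * cos (a * t * x + phi)) -
  a `^ p * (t `^ (p + 1 - 1) * expR (- (a * t)) * cos (a * t * x + phi)) +
  a `^ p * x * (t `^ (p + 1 - 1) * expR (- (a * t)) * cos (a * t * x + (phi + pi / 2))).
have powS (t : R) : 0 < t -> t `^ (p + 1 - 1) = t `^ (p - 1) * t.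
  move=> t0.
  by rewrite -{3}(powRr1 (ltW t0)) -powRD ?(gt_eqF t0) ?implybT// addrAC.
have If (a : R) : 0 < a -> \int[leb]_(t in P) f a t = gamma_cos p phi x.
  move=> a0; have sc := @integral_scaling _ a
    (fun t => t `^ (p - 1) * expR (- t) * cos (x * t + phi)) a0.
  rewrite /gamma_cos /Rintegral sc; last first.
    move=> y y0; apply: continuousM; first apply: continuousM.
    - exact: continuous_powR.
    - by apply: continuous_comp; [exact: continuousN|exact: continuous_expR].
    - apply: continuous_comp; last exact: continuous_cos.
      by apply: cvgD; [apply: cvgM; [exact: cvg_cst|exact: cvg_id]|exact: cvg_cst].
  congr fine; apply: eq_integral_gt0 => t t0; congr EFin; rewrite /f.
  have -> : a `^ p = a `^ (p - 1) * a.
    by rewrite -{3}(powRr1 (ltW a0)) -powRD ?(gt_eqF a0) ?implybT// subrK.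
  by rewrite powRM ?ltW// (mulrC x); ring.
have df (a t : R) : 1 / 2 < a < 2 -> 0 < t -> is_derive a 1 (f ^~ t) (g a t).
  move=> /andP[a12 _] t0; have a0 : 0 < a by lra.
  have da := is_derive1_powR p a0.
  apply: is_derive_eq.
  rewrite /g /GRing.scale/= addrA cosDpihalf powS//; ring.
have cos1 (y : R) : `|cos y| <= 1 by rewrite ler_norml cos_geN1 cos_le1.
(* A majorant of [g a t] for a in ]1/2, 2[: a^p <= 2^p, a^(p-1) = a^p / a <= 2^p * 2 whatever the
   sign of p - 1, and e^(-a t) <= e^(-t/2). The last two terms of [g] share one order of Gamma
   integrand, whence [1 + |x|]. *)
pose G (t : R) := p * 2 `^ p * 2 * (t `^ (p - 1) * expR (- (1 / 2 * t))) +
  2 `^ p * (1 + `|x|) * (t `^ (p + 1 - 1) * expR (- (1 / 2 * t))).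
have D : is_derive (1 : R) 1 (fun a => \int[leb]_(t in P) f a t) (\int[leb]_(t in P) g 1 t).
  apply: (@is_derive_integral f g G 1 (1 / 2) 2).
  - by lra.
  - move=> a /andP[a12 _]; have a0 : 0 < a by lra.
    apply: integrable_mull.
    apply: (@eq_integrable _ _ _ leb _ _ (fun t => (t `^ (p - 1) *
      expR (- (a * t)) * cos (a * x * t + phi))%:E)) => //.
      by move=> t _; rewrite (mulrAC a).
    apply: (@integrable_mulr_cos (fun t => t `^ (p - 1) * expR (- (a * t)))).
      by meas.
    exact: gamma_scaled_integrable.
  - by move=> t; rewrite addr_ge0 ?mulr_ge0 ?addr_ge0 ?powR_ge0 ?expR_ge0// ltW.
  - apply: integrable_add; apply: integrable_mull.
      by apply: gamma_scaled_integrable => //; lra.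
    by apply: gamma_scaled_integrable; lra.
  - move=> a t /andP[a12 a2] t0; have a0 : 0 < a by lra.
    have aG : a `^ p <= 2 `^ p by apply: ge0_ler_powR; rewrite ?nnegrE; lra.
    have aG1 : a `^ (p - 1) <= 2 `^ p * 2.
      rewrite powRB ?(gt_eqF a0) ?implybT// powRr1 ?(ltW a0)//.
      rewrite ler_pM ?powR_ge0 ?invr_ge0 ?(ltW a0)//.
      by rewrite invf_ple ?posrE//; lra.
    have E0 : 0 <= expR (- (a * t)) by exact: expR_ge0.
    have EG : expR (- (a * t)) <= expR (- (1 / 2 * t)).
      by rewrite ler_expR lerN2 ler_pM2r// ltW.
    have B q z : `|t `^ q * expR (- (a * t)) * cos z| <=
        t `^ q * expR (- (1 / 2 * t)).
      rewrite 2!normrM (ger0_norm (powR_ge0 _ _)) (ger0_norm E0).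
      by rewrite -[leRHS]mulr1 ler_pM ?mulr_ge0 ?powR_ge0// ler_wpM2l ?powR_ge0.
    rewrite /g /G (mulrDr (2 `^ p)) mulr1 mulrDl [leRHS]addrA.
    apply: (le_trans (ler_normD _ _)); rewrite lerD//; last first.
      rewrite normrM ler_pM// normrM (ger0_norm (powR_ge0 _ _)).
      by rewrite ler_wpM2r.
    apply: (le_trans (ler_normB _ _)); rewrite lerD//.
      rewrite normrM ler_pM// normrM (ger0_norm (powR_ge0 _ _)).
      by rewrite (ger0_norm (ltW p0)) -mulrA ler_wpM2l// ltW.
    by rewrite normrM (ger0_norm (powR_ge0 _ _)) ler_pM ?powR_ge0.
have D0 : is_derive (1 : R) 1 (fun a => \int[leb]_(t in P) f a t) 0.
  apply: (@near_eq_is_derive _ _ _ (cst (gamma_cos p phi x))) => //.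
  near=> a; rewrite If//; near: a.
  exact: lt_nbhsr.
have [_ D1] := D; have [_ D2] := D0.
have : \int[leb]_(t in P) g 1 t = 0 := etrans (esym D1) D2.
have -> : \int[leb]_(t in P) g 1 t = p * gamma_cos p phi x -
    gamma_cos (p + 1) phi x + x * gamma_cos (p + 1) (phi + pi / 2) x.
  have p10 : 0 < p + 1 by lra.
  rewrite /gamma_cos -!RintegralZl//; try exact: gamma_cos_integrable.
  rewrite -RintegralB//; last 2 first.
  - by apply: integrable_mull; exact: gamma_cos_integrable.
  - exact: gamma_cos_integrable.
  rewrite -RintegralD//; last 2 first.
  - apply: integrable_sub; last exact: gamma_cos_integrable.
    by apply: integrable_mull; exact: gamma_cos_integrable.
  - by apply: integrable_mull; exact: gamma_cos_integrable.
  apply: eq_Rintegral => t _.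
  by rewrite /g !powR1 !mul1r mulr1 (mulrC t).
by move/eqP; rewrite addr_eq0 subr_eq => /eqP ->; rewrite addrC.
Unshelve. all: by end_near. Qed.

Let shift_pi (p phi x : R) : 0 < p ->
  gamma_cos p (phi + pi / 2 + pi / 2) x = - gamma_cos p phi x.
Proof.
move=> p0; rewrite /gamma_cos -[RHS]mulN1r -RintegralZl//.
  by apply: eq_Rintegral => t _; rewrite 2!addrA cosDpihalf sinDpihalf mulrN mulN1r.
exact: gamma_cos_integrable.
Qed.

(** The recurrence at [phi] and at [phi + pi / 2], closed up by [shift_pi], is a linear system of
    determinant 1 + x^2 in the two transforms of order [p + 1]. Solving it expresses the derivative
    of [gamma_cos p] through [gamma_cos p] itself at two phases: a linear differential system. *)
Let gamma_cos_succ (p phi x : R) : 0 < p ->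
  gamma_cos (p + 1) (phi + pi / 2) x =
  p * (gamma_cos p (phi + pi / 2) x - x * gamma_cos p phi x) / (1 + x ^+ 2).
Proof.
move=> p0; have e1 := recurrence phi x p0.
have e2 := recurrence (phi + pi / 2) x p0.
have e3 : gamma_cos (p + 1) (phi + pi / 2 + pi / 2) x = - gamma_cos (p + 1) phi x.
  by apply: shift_pi; rewrite addr_gt0.
have x2 : 1 + x ^+ 2 != 0 by rewrite gt_eqF// ltr_pwDl// sqr_ge0.
rewrite e3 in e2; apply: (mulIf x2); rewrite mulfVK//.
rewrite mulrBr e2 mulrCA e1; ring.
Qed.

Lemma gamma_cos0 (p phi : R) : 0 < p -> gamma_cos p phi 0 = Gamma p * cos phi.
Proof.
move=> p0; rewrite /gamma_cos /Gamma mulrC -RintegralZl//; last exact: gamma_integrable.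
by apply: eq_Rintegral => t _; rewrite mul0r add0r mulrC.
Qed.

Lemma Gamma_succ (p : R) : 0 < p -> Gamma (p + 1) = p * Gamma p.
Proof.
move=> p0; have := recurrence 0 0 p0.
by rewrite mul0r subr0 !gamma_cos0 ?addr_gt0// cos0 !mulr1 => <-.
Qed.

Let is_derive_powR_oneDsqr (q y : R) :
  is_derive y 1 (fun z : R => (1 + z ^+ 2) `^ q)
    (q * (1 + y ^+ 2) `^ (q - 1) * (2 * y)).
Proof.
have D0 : 0 < 1 + y ^+ 2 by rewrite ltr_pwDl// sqr_ge0.
have d0 : is_derive y 1 (fun z : R => 1 + z ^+ 2) (2 * y).
  by apply: is_derive_eq; rewrite /GRing.scale/=; ring.
have d := @is_derive1_comp R (@powR R ^~ q) (fun z : R => 1 + z ^+ 2) y _ _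
  (is_derive1_powR q D0) d0.
exact d.
Qed.

(** The quantity [A] below has zero derivative by [gamma_cos_succ], hence keeps its value at 0,
    where the transform is [Gamma p * cos phi]. Its values at [phi] and [phi + pi / 2] are a
    rotation by the angle [p * atan x] of the two transforms, and undoing the rotation gives the
    formula. *)
Lemma gamma_cosE (p phi x : R) : 0 < p ->
  gamma_cos p phi x =
  Gamma p * (1 + x ^+ 2) `^ (- (p / 2)) * cos (p * atan x + phi).
Proof.
move=> p0.
have D0 (y : R) : 0 < 1 + y ^+ 2 by rewrite ltr_pwDl// sqr_ge0.
(* The rotation invariant: real part of [(1 - iy)^p] times the transform. *)
pose A phi y := (1 + y ^+ 2) `^ (p / 2) * (gamma_cos p phi y * cos (p * atan y)
  - gamma_cos p (phi + pi / 2) y * sin (p * atan y)).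
have dA psi (y : R) : is_derive y 1 (A psi) 0.
  have d1 := is_derive_gamma_cos psi y p0.
  have d2 := is_derive_gamma_cos (psi + pi / 2) y p0.
  have d3 : is_derive y 1 (fun y : R => (1 + y ^+ 2) `^ (p / 2))
      (p / 2 * (1 + y ^+ 2) `^ (p / 2 - 1) * (2 * y)).
    exact (is_derive_powR_oneDsqr (p / 2) y).
  apply: is_derive_eq.
  rewrite /GRing.scale/= !gamma_cos_succ//.
  have -> : gamma_cos p (psi + pi / 2 + pi / 2) y = - gamma_cos p psi y.
    exact: shift_pi.
  rewrite powRB ?(gt_eqF (D0 y)) ?implybT// powRr1 ?(ltW (D0 y))//.
  by field; rewrite gt_eqF.
have AE psi : A psi x = Gamma p * cos psi.
  rewrite (is_derive_0_is_cst x 0 (dA psi)) /A atan0 mulr0 cos0 sin0 expr0n/=.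
  by rewrite addr0 powR1 mul1r mulr1 mulr0 subr0 gamma_cos0.
have c2 := shift_pi phi x p0.
have := AE phi; have := AE (phi + pi / 2).
rewrite /A c2 cosDpihalf cosD => e2 e1.
have r0 : (1 + x ^+ 2) `^ (p / 2) != 0 by rewrite gt_eqF// powR_gt0.
rewrite powRN.
have cs : cos (p * atan x) ^+ 2 + sin (p * atan x) ^+ 2 = 1 by exact: cos2Dsin2.
move: cs e1 e2 r0; set r := _ `^ _; set c := cos (p * _); set s := sin (p * _).
set u := gamma_cos p phi x; set v := gamma_cos p _ x => cs e1 e2 r0.
have -> : Gamma p * r^-1 * (c * cos phi - s * sin phi) =
  r^-1 * ((Gamma p * cos phi) * c + (Gamma p * - sin phi) * s) by ring.
rewrite -e1 -e2 (_ : _ + _ = r * u * (c ^+ 2 + s ^+ 2)); last by ring.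
by rewrite cs mulr1 mulKf.
Qed.

End cosine_transform.

(** * The duplication formula *)

Section constant.
Context {R : realType}.
Local Notation leb := (@lebesgue_measure R).
Local Notation P := (`]0, +oo[%classic : set R).

Lemma integral_oppr (D : set R) (f : R -> \bar R) :
  measurable D -> measurable_fun D f ->
  (\int[leb]_(x in D) f x = \int[leb]_(x in -%R @^-1` D) f (- x)%R)%E.
Proof.
move=> mD mf.
have H (g : R -> \bar R) : measurable_fun D g -> (forall x, 0 <= g x)%E ->
    (\int[leb]_(x in D) g x = \int[leb]_(x in -%R @^-1` D) g (- x)%R)%E.
  move=> mg g0.
  rewrite -(@ge0_integral_pushforward _ _ _ _ _ (-%R : measurableTypeR R -> measurableTypeR R)
    (@oppr_measurable _ _) leb D g)//.
  by apply: eq_measure_integral => //= A mA AS; exact/esym/lebesgue_measureN.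
rewrite integralE [RHS]integralE; congr (_ - _)%E.
- rewrite H//; last exact: measurable_funepos.
  by apply: eq_integral => x _; rewrite !funeposE.
- rewrite H//; last exact: measurable_funeneg.
  by apply: eq_integral => x _; rewrite !funenegE.
Qed.

Lemma ge0_integral_mull (k : R) (f : R -> R) : 0 <= k -> measurable_fun setT f ->
  (forall x, 0 < x -> 0 <= f x) ->
  (\int[leb]_(x in P) (k * f x)%:E = k%:E * \int[leb]_(x in P) (f x)%:E)%E.
Proof.
move=> k0 mf f0; rewrite -ge0_integralZl_EFin//.
- by move=> x; rewrite in_gt0 => x0; rewrite lee_fin f0.
- by apply/measurable_EFinP; exact: measurable_funTS.
Qed.

Lemma Gamma1 : Gamma 1 = 1 :> R.
Proof.
suff e : (\int[leb]_(t in `[0%R, +oo[) (expR (- t))%:E = 1%:E)%E.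
  apply: EFin_inj; rewrite EFin_Gamma// -e.
  rewrite -[RHS]integral_itv_obnd_cbnd; last by apply: measurable_funTS; meas.
  by apply: eq_integral_gt0 => t _; rewrite subrr powRr0 mul1r.
rewrite (@ge0_continuous_FTC2y _ _ (fun t => - expR (- t)) 0 0).
- by rewrite oppr0 expR0 -EFinB sub0r opprK.
- by move=> x _; exact: expR_ge0.
- apply: continuous_subspaceT => x.
  by apply: continuous_comp; [exact: continuousN|exact: continuous_expR].
- by rewrite -[X in _ --> X]oppr0; apply: cvgN; exact: cvgr_expR.
- by [].
- apply: cvg_at_right_filter; apply: cvgN.
  by apply: continuous_comp; [exact: continuousN|exact: continuous_expR].
- move=> x _; rewrite derive1E; apply: derive_val; apply: is_derive_eq.
  by rewrite /GRing.scale/=; ring.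
Qed.

Lemma integral_expRN (c : R) : 0 < c ->
  (\int[leb]_(t in P) (expR (- (c * t)))%:E = c^-1%:E)%E.
Proof.
move=> c0; have : (\int[leb]_(t in P) (expR (- t))%:E = 1%:E)%E.
  rewrite -Gamma1 EFin_Gamma//; apply: eq_integral_gt0 => t _.
  by rewrite subrr powRr0 mul1r.
rewrite (integral_scaling c0); last first.
  by move=> y y0; apply: continuous_comp; [exact: continuousN|exact: continuous_expR].
move=> e; rewrite -[RHS]mule1 -e -ge0_integral_mull ?invr_ge0 ?(ltW c0)//.
- by apply: eq_integral_gt0 => t _; rewrite mulrCA mulVf ?gt_eqF// mulr1.
- by meas.
- by move=> x _; rewrite mulr_ge0 ?expR_ge0// ltW.
Qed.

Let powRN12 (y : R) : 0 < y -> (y ^+ 2) `^ (- (1 / 2)) = y^-1.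
Proof.
move=> y0; rewrite powRN -powR_mulrn ?ltW// -powRrM.
by rewrite mulrCA mulfV// mulr1 powRr1 ?ltW.
Qed.

(* Put [b = d^2 exp s], symmetrise in [s], then put [v = 2 d sinh (s / 2)]: the
   integrand becomes the Gaussian [exp (- v^2)]. *)
Lemma integral_sqrt_expR (d : R) : 0 < d ->
  (\int[leb]_(b in P)
     (b `^ (- (1 / 2)) * expR (- (b + d ^+ 4 * b `^ (-1))))%:E =
   (Num.sqrt pi * expR (- (2 * d ^+ 2)))%:E)%E.
Proof.
move=> d0.
(* Under b = c e^s the terms b and d^4 / b become c e^s and c e^-s, while b^(-1/2) is the inverse of
   d e^(s/2). *)
pose c := d ^+ 2; have c0 : 0 < c by rewrite exprn_gt0.
pose E s : R := expR (- (c * (expR s + expR (- s)))).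
pose h s : R := d * expR (s / 2) * E s.
have expR2 (s : R) : expR s = expR (s / 2) ^+ 2.
  by rewrite expr2 -expRD -splitr.
have cexp : continuous (fun s : R => c * expR s).
  by move=> s; apply: cvgM; [exact: cvg_cst|exact: continuous_expR].
have -> : (\int[leb]_(b in P)
     (b `^ (- (1 / 2)) * expR (- (b + d ^+ 4 * b `^ (-1))))%:E =
     \int[leb]_s (h s)%:E)%E.
  rewrite [LHS](@integral_substitutionT _ (fun s => c * expR s) (fun s => c * expR s)
    (fun y => ln (y / c))).
  - apply: eq_integral => s _; congr EFin.
    have -> : d ^+ 4 * (c * expR s) `^ (-1) = c * expR (- s).
      have ce0 : 0 <= c * expR s by rewrite mulr_ge0 ?expR_ge0// ltW.
      rewrite (powR_inv1 ce0) invfM -expRN /c.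
      by field; rewrite gt_eqF.
    rewrite -mulrDr -/(E s) [expR s]expR2 /c -exprMn powRN12 ?mulr_gt0 ?expR_gt0//.
    rewrite /h exprMn; field.
    by rewrite !gt_eqF ?expR_gt0.
  - exact: cexp.
  - by move=> s; rewrite mulr_ge0 ?expR_ge0// ltW.
  - by move=> s t st; rewrite ltr_pM2l// ltr_expR.
  - by move=> s; rewrite in_gt0 mulr_gt0 ?expR_gt0.
  - move=> y; rewrite in_gt0 => y0; rewrite lnK ?posrE ?divr_gt0//.
    by rewrite mulrCA mulfV ?gt_eqF// mulr1.
  - move=> y; rewrite in_gt0 => y0; apply: continuousM.
      exact: continuous_powR.
    apply: continuous_comp; last exact: continuous_expR.
    apply: continuousN; apply: continuousD; first exact: cvg_id.
    by apply: continuousM; [exact: cst_continuous|exact: continuous_powR].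
have mh : measurable_fun setT h by rewrite /h /E; meas.
have h0 s : 0 <= h s by rewrite !mulr_ge0 ?expR_ge0// ltW.
have mhN : measurable_fun setT (fun s : R => h (- s)) by rewrite /h /E; meas.
have hsN s : h s + h (- s) = d * (expR (s / 2) + expR (- s / 2)) * E s.
  by rewrite /h /E opprK (addrC (expR (- s))); ring.
(* The factor [expR (2 * c)] comes from (2 sinh (s/2))^2 = e^s + e^-s - 2. *)
have gauss : (\int[leb]_v (expR (- v ^+ 2))%:E =
    \int[leb]_s (expR (2 * c) / 2 * (h s + h (- s)))%:E)%E.
  (* The positive root of u - 1/u = y / d. It plays the part of e^(s/2), so s = 2 ln u inverts y = 2
     d sinh (s/2). *)
  pose u y := (y / d + Num.sqrt ((y / d) ^+ 2 + 4)) / 2.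
  have u0 y : 0 < u y.
    rewrite divr_gt0//; have : `|y / d| < Num.sqrt ((y / d) ^+ 2 + 4).
      by rewrite -sqrtr_sqr ltr_sqrt ?ltrDl// ltr_wpDl// sqr_ge0.
    by rewrite ltr_norml => /andP[]; lra.
  have uu y : u y - (u y)^-1 = y / d.
    have : (u y - y / d) * u y = 1.
      have q2 : Num.sqrt ((y / d) ^+ 2 + 4) ^+ 2 = (y / d) ^+ 2 + 4.
        by rewrite sqr_sqrtr// addr_ge0// sqr_ge0.
      rewrite /u; move: q2; set q := Num.sqrt _; set w := y / d => q2.
      have -> : ((w + q) / 2 - w) * ((w + q) / 2) = (q ^+ 2 - w ^+ 2) / 4 by field.
      by rewrite q2 addrAC subrr add0r divff.
    have nz : u y != 0 by rewrite gt_eqF.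
    by move=> e; apply: (mulIf nz); rewrite mulrBl mulVf// -e; ring.
  rewrite [LHS](@integral_substitutionT _ (fun s => d * (expR (s / 2) - expR (- s / 2)))
    (fun s => d * (expR (s / 2) + expR (- s / 2)) / 2) (fun y => 2 * ln (u y))).
  - apply: eq_integral => s _; congr EFin.
    rewrite hsN.
    have -> : - (d * (expR (s / 2) - expR (- s / 2))) ^+ 2 =
        2 * c + - (c * (expR s + expR (- s))).
      rewrite [expR s]expR2 [expR (- s)]expR2 exprMn -/c.
      have e1 : expR (s / 2) * expR (- s / 2) = 1.
        by rewrite -expRD mulNr subrr expR0.
      by move: e1; set a := expR (s / 2); set b := expR _ => e1; ring: e1.
    by rewrite expRD -/(E s); field.
  - by move=> s; apply: is_derive_eq; rewrite /GRing.scale/=; field.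
  - move=> s; apply: cvgM; last exact: cvg_cst.
    apply: cvgM; first exact: cvg_cst.
    apply: cvgD.
      apply: continuous_comp; last exact: continuous_expR.
      by apply: cvgM; [exact: cvg_id|exact: cvg_cst].
    apply: continuous_comp; last exact: continuous_expR.
    by apply: cvgM; [apply: cvgN; exact: cvg_id|exact: cvg_cst].
  - by move=> s; rewrite mulr_ge0// mulr_ge0 ?(ltW d0)// addr_ge0 ?expR_ge0.
  - move=> s t st; rewrite ltr_pM2l// ltrD// ?ltrN2 ltr_expR ltr_pM2r//.
    by rewrite ltrN2.
  - by [].
  - move=> y _.
    rewrite [2 * _]mulrC mulfK// mulNr mulfK// expRN lnK ?posrE// uu.
    by rewrite mulrCA mulfV ?gt_eqF// mulr1.
  - move=> y _; apply: continuous_comp; last exact: continuous_expR.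
    by apply: cvgN; exact: exprn_continuous.
clear hsN; clearbody h.
have e : (\int[leb]_s (h s)%:E = \int[leb]_s (h (- s))%:E)%E.
  have mhE : measurable_fun [set: R] (fun s => (h s)%:E) by exact/measurable_EFinP.
  exact: (integral_oppr measurableT mhE).
move: gauss; rewrite integralT_gauss.
under eq_integral do rewrite EFinM EFinD.
have hh0 s : [set: R] s -> (0 <= (h s)%:E + (h (- s))%:E)%E.
  by rewrite -EFinD lee_fin addr_ge0.
have mhh : measurable_fun [set: R] (fun s => (h s)%:E + (h (- s))%:E)%E.
  by apply/measurable_EFinP; exact: measurable_funD.
have k0 : 0 <= expR (2 * c) / 2 by rewrite divr_ge0 ?expR_ge0.
rewrite (ge0_integralZl_EFin leb measurableT hh0 mhh k0).
have h0E s : [set: R] s -> (0 <= (h s)%:E)%E by rewrite lee_fin.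
have hN0E s : [set: R] s -> (0 <= (h (- s))%:E)%E by rewrite lee_fin.
have mhE : measurable_fun [set: R] (fun s => (h s)%:E) by exact/measurable_EFinP.
have mhNE : measurable_fun [set: R] (fun s => (h (- s))%:E) by exact/measurable_EFinP.
rewrite (ge0_integralD leb measurableT h0E mhE hN0E mhNE) -e => eg.
(* The integral of [h] is not yet known to be finite. Twice it, times a positive constant, equals
   the Gaussian integral, which rules out [+oo] and fixes the value; [-oo] is excluded by sign. *)
have : (0 <= \int[leb]_s (h s)%:E)%E by apply: integral_ge0 => s _; rewrite lee_fin.
move: eg; case: (\int[leb]_s (h s)%:E)%E => [r| |].
- rewrite -EFinD -EFinM => -[->] _; congr EFin; rewrite expRN -/c.
  by field; rewrite gt_eqF ?expR_gt0.
- by rewrite addye// gt0_muley// lte_fin divr_gt0 ?expR_gt0.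
- by [].
Qed.

Let powR_expR (a x : R) : 0 < a -> a `^ x = expR (x * ln a).
Proof. by move=> a0; rewrite /powR gt_eqF. Qed.

(** The integrand of Gamma(z + 1/2) at b times that of Gamma(z) at t^2 / (4 b), with its Jacobian.
    The exponent becomes b + (t/2)^2 / b, the shape of [integral_sqrt_expR] with d = (t/2)^(1/2);
    the powers are compared as exponentials of logarithms. *)
Let integrand_dupl (z b t : R) : 0 < b -> 0 < t ->
  b `^ (z + 1 / 2 - 1) * expR (- b) *
  ((1 / (4 * b) * t `^ 2) `^ (z - 1) * expR (- (1 / (4 * b) * t `^ 2)) *
     (1 / (4 * b) * (2 * t `^ (2 - 1)))) =
  2 `^ (1 - 2 * z) * (t `^ (2 * z - 1) *
    (b `^ (- (1 / 2)) * expR (- (b + ((t / 2) `^ (1 / 2)) ^+ 4 * b `^ (-1))))).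
Proof.
move=> b0 t0.
have -> : ((t / 2) `^ (1 / 2)) ^+ 4 = (t / 2) ^+ 2.
  rewrite -!powR_mulrn ?powR_ge0 ?divr_ge0 ?(ltW t0)// -powRrM.
  by congr (_ `^ _); field.
rewrite powR_inv1 ?(ltW b0)//.
have b40 : 0 < 1 / (4 * b) by rewrite divr_gt0 ?mulr_gt0.
have lnb4 : ln (1 / (4 * b)) = - (2 * ln 2) - ln b.
  rewrite mul1r lnV ?posrE ?mulr_gt0// lnM ?posrE//.
  have -> : 4 = 2 * 2 :> R by ring.
  by rewrite lnM ?posrE//; ring.
have t2E : t `^ 2 = t ^+ 2 by rewrite -[RHS]powR_mulrn// ltW.
have -> : 1 / (4 * b) * (2 * t `^ (2 - 1)) = expR (- ln 2 - ln b + ln t).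
  have -> : - ln 2 - ln b + ln t = ln (1 / (4 * b)) + (ln 2 + ln t) by rewrite lnb4; ring.
  rewrite !expRD !lnK ?posrE//.
  by rewrite (_ : 2 - 1 = 1); [rewrite powRr1 ?(ltW t0)|ring].
have t20 : 0 < t `^ 2 by exact: powR_gt0.
rewrite (powR_expR (z - 1) (mulr_gt0 b40 t20)).
rewrite (lnM b40 t20) lnb4 ln_powR t2E.
rewrite (powR_expR (z + 1 / 2 - 1) b0) (powR_expR (- (1 / 2)) b0).
rewrite (powR_expR (2 * z - 1) t0) (powR_expR _ (ltr0Sn R 1)) -!expRD; congr expR.
by field; rewrite gt_eqF.
Qed.

(** The product is a double integral. After the substitution of [integrand_dupl] and Tonelli, the
    [b]-integral equals sqrt(pi) e^(-t), since 2 d^2 = t, and the Gamma(2z) integrand is left in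
    [t]. *)
Lemma Gamma_duplication (z : R) : 0 < z ->
  Gamma z * Gamma (z + 1 / 2) = 2 `^ (1 - 2 * z) * Num.sqrt pi * Gamma (2 * z).
Proof.
move=> z0.
pose f (b t : R) : R := t `^ (2 * z - 1) *
  (b `^ (- (1 / 2)) * expR (- (b + ((t / 2) `^ (1 / 2)) ^+ 4 * b `^ (-1)))).
pose k : R := 2 `^ (1 - 2 * z).
have k0 : 0 <= k by exact: powR_ge0.
have f0 b t : 0 <= f b t by rewrite !mulr_ge0 ?powR_ge0 ?expR_ge0.
have in1 b : 0 < b -> (\int[leb]_(t in P) (k * f b t)%:E =
    (Gamma z)%:E * (b `^ (z + 1 / 2 - 1) * expR (- b))%:E)%E.
  move=> b0; rewrite EFin_Gamma//.
  rewrite [X in _ = (X * _)%E](@integral_powR_substitution _ (1 / (4 * b)) 2)//.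
  - rewrite muleC -ge0_integral_mull ?mulr_ge0 ?powR_ge0 ?expR_ge0//.
    + apply: eq_integral_gt0 => t t0; congr EFin.
      by rewrite /k /f -integrand_dupl.
    + by meas.
    + by move=> t t0; rewrite !mulr_ge0 ?powR_ge0 ?expR_ge0// invr_ge0 mulr_ge0// ltW.
  - by rewrite divr_gt0// mulr_gt0.
  - move=> y y0; apply: continuousM; first exact: continuous_powR.
    by apply: continuous_comp; [exact: continuousN|exact: continuous_expR].
have in2 t : 0 < t -> (\int[leb]_(b in P) (k * f b t)%:E =
    (k * Num.sqrt pi * (t `^ (2 * z - 1) * expR (- t)))%:E)%E.
  move=> t0; have d0 : 0 < (t / 2) `^ (1 / 2) by rewrite powR_gt0// divr_gt0.
  have -> : (\int[leb]_(b in P) (k * f b t)%:E = \int[leb]_(b in P)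
     (k * t `^ (2 * z - 1) * (b `^ (- (1 / 2)) *
        expR (- (b + ((t / 2) `^ (1 / 2)) ^+ 4 * b `^ (-1)))))%:E)%E.
    by apply: eq_integral_gt0 => b _; rewrite /f mulrA.
  rewrite ge0_integral_mull ?mulr_ge0 ?powR_ge0//.
  - rewrite integral_sqrt_expR// -EFinM; congr EFin.
    rewrite -[_ ^+ 2]powR_mulrn ?powR_ge0// -powRrM.
    have -> : 1 / 2 * 2%:R = 1 :> R by field.
    rewrite powRr1 ?divr_ge0 ?(ltW t0)//.
    have -> : 2 * (t / 2) = t by field.
    by ring.
  - by meas.
  - by move=> b b0; rewrite !mulr_ge0 ?powR_ge0 ?expR_ge0.
have z20 : 0 < 2 * z by rewrite mulr_gt0.
have zh0 : 0 < z + 1 / 2 by lra.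
have eL : (\int[leb]_(b in P) \int[leb]_(t in P) (k * f b t)%:E =
    (Gamma z * Gamma (z + 1 / 2))%:E)%E.
  rewrite EFinM (EFin_Gamma zh0) -ge0_integral_mull ?(ltW (Gamma_gt0 _))//.
  - by apply: eq_integral_gt0 => b b0; rewrite in1// -EFinM.
  - by meas.
  - by move=> b b0; rewrite !mulr_ge0 ?powR_ge0 ?expR_ge0.
have eR : (\int[leb]_(t in P) \int[leb]_(b in P) (k * f b t)%:E =
    (k * Num.sqrt pi * Gamma (2 * z))%:E)%E.
  rewrite EFinM (EFin_Gamma z20) -ge0_integral_mull ?mulr_ge0 ?sqrtr_ge0//.
  - by apply: eq_integral_gt0 => t t0; rewrite in2.
  - by meas.
  - by move=> b b0; rewrite !mulr_ge0 ?powR_ge0 ?expR_ge0.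
apply: EFin_inj; rewrite -eL -eR.
apply: (@tonelli_gt0 _ (fun p => (k * f p.1 p.2)%:E)).
- by rewrite /f; meas.
- by move=> b t _ _; rewrite lee_fin mulr_ge0.
Qed.
End constant.

(** * The symbol of the fractional Laplacian *)

Section constant_oneBcos.
Context {R : realType}.
Local Notation leb := (@lebesgue_measure R).
Local Notation P := (`]0, +oo[%classic : set R).
Variable alpha : R.
Hypotheses (alpha_gt0 : 0 < alpha) (alpha_lt2 : alpha < 2).

Let a1 : 0 < 1 - alpha / 2. Proof. by move: alpha_lt2; lra. Qed.
Let a2 : 0 < alpha / 2. Proof. by move: alpha_gt0; lra. Qed.
Let a3 : 0 < 1 / 2 + alpha / 2. Proof. by move: alpha_gt0; lra. Qed.
Let a4 : 0 < 1 + alpha. Proof. by move: alpha_gt0; lra. Qed.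

Let k (t y : R) : R := (1 - cos (t * y)) * y `^ (- (1 + alpha)).
(** Valued in [\bar R], because finiteness of [K 1] emerges only in [K1E], from the finiteness of
    its product with [Gamma (1 + alpha)]. *)
Let K (t : R) : \bar R := (\int[leb]_(y in P) (k t y)%:E)%E.

Let k_ge0 t y : 0 <= k t y.
Proof. by rewrite mulr_ge0 ?powR_ge0// subr_ge0 cos_le1. Qed.

Let mk t : measurable_fun setT (k t).
Proof. by rewrite /k; meas. Qed.

Let K_scaling t : 0 < t -> (K t = (t `^ alpha)%:E * K 1)%E.
Proof.
move=> t0; rewrite /K [in RHS](integral_scaling t0); last first.
  move=> y y0; apply: continuousM; last exact: continuous_powR.
  apply: cvgB; first exact: cvg_cst.
  apply: continuous_comp; last exact: continuous_cos.
  by apply: cvgM; [exact: cvg_cst|exact: cvg_id].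
rewrite -ge0_integral_mull ?powR_ge0//; first last.
- by move=> y y0; rewrite mulr_ge0 ?k_ge0// ltW.
- by rewrite /k; meas.
apply: eq_integral_gt0 => y y0; congr EFin; rewrite /k mul1r.
rewrite powRM ?(ltW t0) ?(ltW y0)//.
have : t `^ alpha * t `^ (- (1 + alpha)) * t = 1.
  rewrite -{3}(powRr1 (ltW t0)) -!powRD ?(gt_eqF t0) ?implybT//.
  by rewrite (_ : _ + _ = 0) ?powRr0//; ring.
move: (t `^ alpha) (t `^ (- _)) => A B e.
by rewrite -[LHS]mul1r -[X in X * _ = _]e; ring.
Qed.

Let laplace_oneBcos (y : R) :
  (\int[leb]_(t in P) (expR (- t) * (1 - cos (t * y)))%:E =
   (y ^+ 2 * (1 + y ^+ 2)^-1)%:E)%E.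
Proof.
have y2 : 0 < 1 + y ^+ 2 by rewrite ltr_pwDl// sqr_ge0.
have i1 : leb.-integrable P (fun t => (t `^ (1 - 1) * expR (- t))%:E).
  by apply: gamma_integrable.
have i2 : leb.-integrable P
    (fun t => (t `^ (1 - 1) * expR (- t) * cos (y * t + 0))%:E).
  by apply: integrable_mulr_cos => //; meas.
rewrite (@eq_integral_gt0 _ _ (fun t => ((t `^ (1 - 1) * expR (- t))%:E -
    (t `^ (1 - 1) * expR (- t) * cos (y * t + 0))%:E)%E)); last first.
  move=> t _; rewrite -EFinB subrr powRr0 addr0 (mulrC y) mul1r; congr EFin; ring.
rewrite integralB_EFin// -EFin_Gamma// Gamma1.
have -> : (\int[leb]_(t in P) (t `^ (1 - 1) * expR (- t) * cos (y * t + 0))%:E =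
    (gamma_cos 1 0 y)%:E)%E.
  by rewrite /gamma_cos /Rintegral fineK//; exact: (integrable_fin_num _ i2).
rewrite gamma_cosE// Gamma1 !mul1r addr0 cos_atan -EFinB; congr EFin.
have -> : (1 + y ^+ 2) `^ (- 2^-1) = (Num.sqrt (1 + y ^+ 2))^-1.
  by rewrite powRN powR12_sqrt// ltW.
rewrite -invfM -expr2 sqr_sqrtr ?(ltW y2)//.
by field; rewrite gt_eqF.
Qed.

(** Write 1 / (1 + y^2) as the integral of e^(-v (1 + y^2)) over v > 0 and exchange. In [y], the
    variable v y^2 gives Gamma(1 - alpha/2) v^(alpha/2 - 1) / 2; the [v]-integral is then
    Gamma(alpha/2). *)
Let J : (\int[leb]_(y in P) (y `^ (- (1 + alpha)) * (y ^+ 2 * (1 + y ^+ 2)^-1))%:E =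
  (Gamma (1 - alpha / 2) * Gamma (alpha / 2) / 2)%:E)%E.
Proof.
pose f (v y : R) : R := y `^ (1 - alpha) * expR (- (v * (1 + y ^+ 2))).
have in1 y : 0 < y -> (\int[leb]_(v in P) (f v y)%:E =
    (y `^ (- (1 + alpha)) * (y ^+ 2 * (1 + y ^+ 2)^-1))%:E)%E.
  move=> y0; have y2 : 0 < 1 + y ^+ 2 by rewrite ltr_pwDl// sqr_ge0.
  rewrite ge0_integral_mull ?powR_ge0//; last by meas.
  under eq_integral do rewrite mulrC.
  rewrite integral_expRN// -EFinM mulrA; congr (_ * _)%:E.
  rewrite -powR_mulrn ?(ltW y0)// -powRD ?(gt_eqF y0) ?implybT//.
  by congr (_ `^ _); ring.
have in2 v : 0 < v -> (\int[leb]_(y in P) (f v y)%:E =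
    (Gamma (1 - alpha / 2) / 2 * (v `^ (alpha / 2 - 1) * expR (- v)))%:E)%E.
  move=> v0; have c0 : 0 <= v `^ (alpha / 2 - 1) * expR (- v) / 2.
    by rewrite divr_ge0// mulr_ge0 ?powR_ge0 ?expR_ge0.
  have -> : Gamma (1 - alpha / 2) / 2 * (v `^ (alpha / 2 - 1) * expR (- v)) =
      v `^ (alpha / 2 - 1) * expR (- v) / 2 * Gamma (1 - alpha / 2) by ring.
  rewrite EFinM (EFin_Gamma a1).
  rewrite [X in _ = (_ * X)%E](@integral_powR_substitution _ v 2)//; last first.
    move=> y y0; apply: continuousM; first exact: continuous_powR.
    by apply: continuous_comp; [exact: continuousN|exact: continuous_expR].
  rewrite -ge0_integral_mull//; last 2 first.
  - by meas.
  - by move=> y y0; rewrite !mulr_ge0 ?powR_ge0 ?expR_ge0// ltW.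
  apply: eq_integral_gt0 => y y0; congr EFin; rewrite /f.
  have v2 : 0 < v * y `^ 2 by rewrite mulr_gt0// powR_gt0.
  have y2E : y `^ 2 = y ^+ 2 by rewrite -[RHS]powR_mulrn// ltW.
  have -> : v * (2 * y `^ (2 - 1)) = 2 * expR (ln v + ln y).
    rewrite expRD !lnK ?posrE// (_ : 2 - 1 = 1) ?powRr1 ?(ltW y0)//; ring.
  have pE (a x : R) : 0 < a -> a `^ x = expR (x * ln a).
    by move=> a0; rewrite /powR gt_eqF.
  rewrite (pE _ _ v2) (lnM v0 (powR_gt0 _ y0)) ln_powR y2E (pE _ _ y0) (pE _ _ v0).
  have -> : expR ((alpha / 2 - 1) * ln v) * expR (- v) / 2 *
     (expR ((1 - alpha / 2 - 1) * (ln v + 2 * ln y)) * expR (- (v * y ^+ 2)) *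
      (2 * expR (ln v + ln y))) =
     expR ((alpha / 2 - 1) * ln v) * expR (- v) *
     (expR ((1 - alpha / 2 - 1) * (ln v + 2 * ln y)) * expR (- (v * y ^+ 2)) *
      expR (ln v + ln y)) by field.
  by rewrite -!expRD; congr expR; field.
have mf : measurable_fun setT (fun p : R * R => (f p.2 p.1)%:E) by rewrite /f; meas.
have := @tonelli_gt0 R (fun p => (f p.2 p.1)%:E) mf.
rewrite /= => H; rewrite -(eq_integral_gt0 in1) H; last first.
  by move=> x y _ _; rewrite lee_fin mulr_ge0 ?powR_ge0 ?expR_ge0.
rewrite (eq_integral_gt0 in2) ge0_integral_mull.
- by rewrite -(EFin_Gamma a2) -EFinM; congr EFin; ring.
- by apply: divr_ge0; [exact: ltW (Gamma_gt0 a1)|].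
- by meas.
- by move=> v v0; rewrite mulr_ge0 ?powR_ge0 ?expR_ge0.
Qed.

Let K1_Gamma : (K 1 * (Gamma (1 + alpha))%:E =
  (Gamma (1 - alpha / 2) * Gamma (alpha / 2) / 2)%:E)%E.
Proof.
have K0 : (0 <= K 1)%E by apply: integral_ge0 => y _; rewrite lee_fin.
pose f (t y : R) : R := y `^ (- (1 + alpha)) * (expR (- t) * (1 - cos (t * y))).
have in1 t : 0 < t -> (\int[leb]_(y in P) (f t y)%:E =
    (t `^ (1 + alpha - 1) * expR (- t))%:E * K 1)%E.
  move=> t0; rewrite mulrC EFinM -muleA (_ : 1 + alpha - 1 = alpha); last by ring.
  rewrite -K_scaling// -ge0_integral_mull ?expR_ge0//.
  by apply: eq_integral_gt0 => y _; rewrite /f /k; congr EFin; ring.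
have in2 y : 0 < y -> (\int[leb]_(t in P) (f t y)%:E =
    (y `^ (- (1 + alpha)) * (y ^+ 2 * (1 + y ^+ 2)^-1))%:E)%E.
  move=> y0; rewrite ge0_integral_mull ?powR_ge0//.
  - by rewrite laplace_oneBcos.
  - by meas.
have mf : measurable_fun setT (fun p : R * R => (f p.1 p.2)%:E) by rewrite /f; meas.
have := @tonelli_gt0 R (fun p => (f p.1 p.2)%:E) mf.
rewrite /= => H; rewrite -J -(eq_integral_gt0 in2) -H; last first.
  by move=> x y _ _; rewrite lee_fin mulr_ge0 ?powR_ge0// mulr_ge0 ?expR_ge0.
rewrite (eq_integral_gt0 in1) ge0_integralZr//.
- by rewrite -(EFin_Gamma a4) muleC.
- exact: gamma_measurable.
- by move=> t _; rewrite lee_fin mulr_ge0 ?powR_ge0 ?expR_ge0.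
Qed.

Lemma frac_const_gt0 : 0 < frac_const alpha.
Proof.
rewrite /frac_const; apply: mulr_gt0 => //; apply: divr_gt0; apply: mulr_gt0.
- exact: powR_gt0.
- exact: Gamma_gt0 a3.
- by rewrite sqrtr_gt0 pi_gt0.
- exact: Gamma_gt0 a1.
Qed.

Let K1E : K 1 = (1 / (2 * frac_const alpha))%:E.
Proof.
have G0 := Gamma_gt0 a4.
have K0 : (0 <= K 1)%E by apply: integral_ge0 => y _; rewrite lee_fin.
move: K1_Gamma K0; case: (K 1) => [r| |]//; last by rewrite gt0_mulye ?lte_fin.
rewrite -EFinM => -[rE] _; congr EFin.
(* At [z = alpha / 2], duplication trades Gamma(alpha/2) for Gamma(1/2 + alpha/2), the factor in
   [frac_const], at the cost of Gamma(alpha) = Gamma(1 + alpha) / alpha. *)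
have dup := Gamma_duplication a2.
have e2 : 2 * (alpha / 2) = alpha by field.
rewrite e2 in dup.
have GS := Gamma_succ alpha_gt0; rewrite addrC in GS.
have g1 := Gamma_gt0 a1.
have g2 := Gamma_gt0 a3.
have p2 : 0 < Num.sqrt pi :> R by rewrite sqrtr_gt0 pi_gt0.
have two : 2 `^ (1 - alpha) * 2 `^ (alpha - 1) = 1 :> R.
  by rewrite -(opprB 1 alpha) powRN mulfV// gt_eqF// powR_gt0.
rewrite /frac_const.
apply: (@mulIf _ (Gamma (1 + alpha))); first by rewrite gt_eqF.
rewrite rE GS; rewrite (addrC (alpha / 2)) in dup.
move: g1 g2 p2 two dup; set a := Gamma (alpha / 2); set b := Gamma (1 / 2 + _).
set c := Gamma (1 - _); set g := Gamma alpha; set p := Num.sqrt pi.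
have Y0 : 0 < 2 `^ (alpha - 1) :> R by rewrite powR_gt0.
move: Y0; set Y := 2 `^ (alpha - 1); set X := 2 `^ (1 - alpha).
clearbody a b c g p X Y => Y0 c0 b0 p0 XY dup.
have pg : p * g = a * b * Y by rewrite dup -[LHS]mul1r -XY; ring.
have -> : 1 / (2 * (alpha * (Y * b / (p * c)))) * (alpha * g) =
    c * (p * g) / (2 * Y * b).
  by field; rewrite !gt_eqF.
by rewrite pg; field; rewrite !gt_eqF.
Qed.

Lemma integral_oneBcos t : 0 < t ->
  (\int[leb]_(y in P) ((1 - cos (t * y)) * y `^ (- (1 + alpha)))%:E =
   (t `^ alpha / (2 * frac_const alpha))%:E)%E.
Proof. by move=> t0; rewrite -/(K t) K_scaling// K1E -EFinM div1r. Qed.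

End constant_oneBcos.

(** * Principal values of superpositions of cosines *)

Section truncation.
Context {R : realType}.
Local Notation leb := (@lebesgue_measure R).
Local Notation P := (`]0, +oo[%classic : set R).
Local Notation outside e := ([set y | e < `|y|] : set R).

Lemma outsideE (e : R) : 0 < e ->
  outside e = `]e, +oo[%classic `|` (-%R @^-1` `]e, +oo[%classic).
Proof.
move=> e0; apply/seteqP; split => y /=; rewrite !in_itv/= !andbT.
  by rewrite lter_normr => /orP[]; [left|right].
by rewrite lter_normr => -[->|->]//; rewrite orbT.
Qed.

Lemma measurable_outside (e : R) : measurable (outside e).
Proof.
rewrite (_ : outside e = setT `&` ((fun y : R => `|y|) @^-1` `]e, +oo[%classic)).
  by apply: normr_measurable.
by apply/seteqP; split => y /=; rewrite in_itv/= andbT => // -[].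
Qed.

Lemma integral_outside (e : R) (g : R -> \bar R) : 0 < e ->
  measurable_fun (outside e) g ->
  (\int[leb]_(y in outside e) g y =
   \int[leb]_(y in `]e, +oo[) g y + \int[leb]_(y in `]e, +oo[) g (- y)%R)%E.
Proof.
move=> e0; rewrite outsideE// => mg.
have mN : measurable (-%R @^-1` `]e, +oo[%classic : set R).
  rewrite -[X in measurable X]setTI.
  exact: (@oppr_measurable R setT measurableT `]e, +oo[%classic).
rewrite integral_setU//; first congr (_ + _)%E.
- rewrite [LHS]integral_oppr//; last first.
    by apply: (measurable_funS _ _ mg); [exact: measurableU|exact: subsetUr].
  by congr integral; apply/seteqP; split => y /=; rewrite opprK.
- rewrite disj_set2E; apply/eqP; rewrite -subset0 => y [] /=.
  by rewrite !in_itv/= !andbT; lra.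
Qed.

Lemma integrable_powRN_tail (a e : R) : 0 < a -> 0 < e ->
  (\int[leb]_(y in `]e, +oo[) (y `^ (- (1 + a)))%:E < +oo)%E.
Proof.
move=> a0 e0.
rewrite (@integral_substitution_gt0 _ (fun s => e * expR s) (fun s => e * expR s)
  (fun y => ln (y / e))).
- rewrite (@eq_integral_gt0 _ _ (fun s => (e `^ (- a) * expR (- (a * s)))%:E)).
    rewrite ge0_integral_mull ?powR_ge0//; last by meas.
    by rewrite integral_expRN// -EFinM ltry.
  move=> s s0; congr EFin; rewrite powRM ?(ltW e0) ?expR_ge0//.
  rewrite -expRM -{2}(powRr1 (ltW e0)) mulrACA.
  rewrite -powRD ?(gt_eqF e0) ?implybT// -expRD.
  by congr (_ `^ _ * expR _); ring.
- by move=> s s0; apply: cvgM; [exact: cvg_cst|exact: continuous_expR].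
- by move=> s s0; rewrite mulr_ge0 ?expR_ge0// ltW.
- by move=> s t s0 st; rewrite ltr_pM2l// ltr_expR.
- by move=> s s0; rewrite /= in_itv/= andbT ltr_pMr// expR_gt1.
- move=> y; rewrite /= in_itv/= andbT => ey; have y0 := lt_trans e0 ey.
  rewrite ln_gt0 ?ltr_pdivlMr ?mul1r// lnK ?posrE ?divr_gt0//.
  by rewrite mulrCA mulfV ?gt_eqF// mulr1.
- move=> y; rewrite /= in_itv/= andbT => ey.
  exact: continuous_powR (lt_trans e0 ey).
Qed.

Lemma integrable_outside_div_powR (a e M : R) (u : R -> R) : 0 < a -> 0 < e ->
  measurable_fun setT u -> (forall y, `|u y| <= M) ->
  leb.-integrable (outside e) (fun y => (u y / `|y| `^ (1 + a))%:E).
Proof.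
move=> a0 e0 mu uM.
have mo := measurable_outside e.
have mp : measurable_fun [set: R] (fun y : R => (`|y| `^ (- (1 + a)))%:E) by meas.
apply: (@le_integrable _ _ _ leb _ mo _
  (fun y => M%:E * (`|y| `^ (- (1 + a)))%:E)%E).
- apply: measurable_funTS.
  rewrite (_ : (fun y => _) = (fun y => (u y * `|y| `^ (- (1 + a)))%:E)).
    by meas.
  by apply/funext => y; rewrite powRN.
- move=> y _; rewrite -EFinM -powRN lee_fin !normrM (ger0_norm (powR_ge0 _ _)).
  by rewrite ler_wpM2r ?powR_ge0// (le_trans (uM y))// ler_norm.
- apply: integrableZl => //; apply/integrableP; split; first exact: measurable_funTS.
  under eq_integral do rewrite gee0_abs ?lee_fin ?powR_ge0//.
  rewrite integral_outside//; last exact: measurable_funTS.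
  have tail (q : R -> \bar R) : (forall y : R, e < y -> q y = (y `^ (- (1 + a)))%:E) ->
      (\int[leb]_(y in `]e, +oo[) q y < +oo)%E.
    move=> qE; suff -> : (\int[leb]_(y in `]e, +oo[) q y =
      \int[leb]_(y in `]e, +oo[) (y `^ (- (1 + a)))%:E)%E by exact: integrable_powRN_tail.
    by apply: eq_integral => y; rewrite inE/= in_itv/= andbT; exact: qE.
  rewrite lte_add_pinfty// tail// => y ey.
    by rewrite gtr0_norm// (lt_trans e0).
  by rewrite normrN gtr0_norm// (lt_trans e0).
Qed.

(** Dominated convergence along any positive sequence tending to 0: the restrictions of [h] are
    bounded by [|h|], and every [y > 0] eventually lies in []u n, +oo[]. *)
Lemma cvg_Rintegral_tail (h : R -> R) : leb.-integrable P (EFin \o h) ->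
  \int[leb]_(y in `]e, +oo[) h y @[e --> 0^'+] --> \int[leb]_(y in P) h y.
Proof.
move=> ih; apply/cvg_at_rightP => u [u0 ucvg].
have mh := measurable_int _ ih.
pose f_ n : R -> \bar R := (EFin \o h) \_ (`]u n, +oo[%classic).
have fE n : (\int[leb]_(y in `]u n, +oo[) (h y)%:E = \int[leb]_(y in P) f_ n y)%E.
  rewrite -integral_mkcondr; congr integral; apply/seteqP; split => y /=.
    by rewrite !in_itv/= !andbT => uy; split => //; exact: lt_trans uy.
  by case.
have [_ _ dc] : [/\ leb.-integrable P (EFin \o h),
   [sequence (\int[leb]_(x in P) `|f_ n x - (EFin \o h) x|)%E]_n x @[x --> \oo] --> 0%E
   & [sequence (\int[leb]_(x in P) f_ n x)%E]_n x @[x --> \oo] -->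
       (\int[leb]_(x in P) (EFin \o h) x)%E].
  apply: (@dominated_convergence _ _ _ leb P _ f_ (EFin \o h) (abse \o EFin \o h)) => //.
  - move=> n; apply/measurable_restrict => //.
    by apply: (measurable_funS _ _ mh) => //; exact: subIsetr.
  - apply/aeW => y; rewrite in_gt0 => y0.
    apply: cvg_near_cst; near=> n; rewrite /f_ patchE ifT//.
    rewrite inE/= in_itv/= andbT; near: n.
    exact: (cvgr_lt _ ucvg _ y0).
  - exact: integrable_abse.
  - apply/aeW => y n _; rewrite /f_ patchE; case: ifPn => //= _.
    by rewrite lee_fin normr0.
rewrite /Rintegral; under eq_fun do rewrite fE.
apply: fine_cvg; rewrite fineK//.
exact: (integrable_fin_num _ ih).
Unshelve. all: by end_near. Qed.

End truncation.

(** * The fractional Laplacian of a superposition of cosines *)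

Section cosine_superposition.
Context {R : realType}.
Local Notation leb := (@lebesgue_measure R).
Local Notation P := (`]0, +oo[%classic : set R).
Variables (alpha : R) (w : R -> R) (phi : R).
Hypotheses (alpha_gt0 : 0 < alpha) (alpha_lt2 : alpha < 2).
Hypothesis mw : measurable_fun setT w.
Hypothesis iw : leb.-integrable P (EFin \o w).
Hypothesis iwa : leb.-integrable P (fun t => (w t * t `^ alpha)%:E).

Definition superposition (x : R) : R := \int[leb]_(t in P) (w t * cos (x * t + phi)).
Local Notation f := superposition.
Variable x : R.

Let g (y : R) : R := (f x - f (x + y)) / `|y| `^ (1 + alpha).
(** The folded integrand g(y) + g(-y), see [gh]. The part of the difference that is odd in [y] has
    cancelled, and [h] turns out to be integrable up to [y = 0]. *)
Let h (y : R) : R := y `^ (- (1 + alpha)) *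
  \int[leb]_(t in P) (w t * (2 * cos (x * t + phi) * (1 - cos (t * y)))).

Let iwcos y : leb.-integrable P (fun t => (w t * cos (y * t + phi))%:E).
Proof. exact: integrable_mulr_cos. Qed.

Let f_bound y : `|f y| <= \int[leb]_(t in P) `|w t|.
Proof.
apply: le_trans (le_normr_Rintegral _ _) _ => //; first exact: iwcos.
apply: le_Rintegral => //.
- exact: integrable_norm (iwcos y).
- exact: integrable_norm iw.
- move=> t _; rewrite normrM ler_piMr// ler_norml cos_geN1 cos_le1//.
Qed.

Let f_continuous : continuous f.
Proof.
move=> a.
have := @continuity_under_integral R _ _ leb (fun y t => w t * cos (y * t + phi)) P
  _ (a - 1) (a + 1) (fun y _ => iwcos y) _ (fun t => `|w t|) (integrable_norm iw) _ a.
apply => //.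
- apply/aeW => t _ y _; apply: cvgM; first exact: cvg_cst.
  apply: continuous_comp; last exact: continuous_cos.
  by apply: cvgD; [apply: cvgM; [exact: cvg_id|exact: cvg_cst]|exact: cvg_cst].
- move=> y _; apply/aeW => t _.
  by rewrite normrM ler_piMr// ler_norml cos_geN1 cos_le1.
- by rewrite inE/= in_itv/=; lra.
Qed.

Let mf : measurable_fun setT f.
Proof. exact: continuous_measurable_fun f_continuous. Qed.

Let g_integrable e : 0 < e -> leb.-integrable [set y | e < `|y|] (EFin \o g).
Proof.
move=> e0; apply: (@integrable_outside_div_powR _ _ _
  (\int[leb]_(t in P) `|w t| + \int[leb]_(t in P) `|w t|)) => //.
- apply: measurable_funB => //.
  by apply: (measurableT_comp mf); exact: measurable_funD.
- by move=> y; rewrite (le_trans (ler_normB _ _))// lerD.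
Qed.

Let second_difference y t :
  w t * cos (x * t + phi) - w t * cos ((x + y) * t + phi) +
  (w t * cos (x * t + phi) - w t * cos ((x - y) * t + phi)) =
  w t * (2 * cos (x * t + phi) * (1 - cos (t * y))).
Proof.
have -> : (x + y) * t + phi = (x * t + phi) + t * y by ring.
have -> : (x - y) * t + phi = (x * t + phi) - t * y by ring.
by move: (x * t + phi) => z; rewrite cosD cosB; ring.
Qed.

Let h_integrand_integrable y : leb.-integrable P
  (fun t => (w t * (2 * cos (x * t + phi) * (1 - cos (t * y))))%:E).
Proof.
have i1 := integrable_sub (iwcos x) (iwcos (x + y)).
have i2 := integrable_sub (iwcos x) (iwcos (x - y)).
have := integrable_add i1 i2; apply: eq_integrable => // t _.
by rewrite second_difference.
Qed.

Let gh y : 0 < y -> g y + g (- y) = h y.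
Proof.
move=> y0; rewrite /g /h normrN gtr0_norm// -mulrDl -powRN mulrC; congr (_ * _).
rewrite /superposition -!RintegralB//; try exact: iwcos.
rewrite -RintegralD//; last 2 first.
- exact: integrable_sub (iwcos _) (iwcos _).
- exact: integrable_sub (iwcos _) (iwcos _).
by apply: eq_Rintegral => t _; exact: second_difference.
Qed.

Let F (y t : R) : R := w t * (2 * cos (x * t + phi)) *
  ((1 - cos (t * y)) * y `^ (- (1 + alpha))).

Let mF : measurable_fun setT (fun p : R * R => (F p.1 p.2)%:E).
Proof. by rewrite /F; meas; exact: (measurableT_comp mw measurable_snd). Qed.

Let k_integrable t : 0 < t -> leb.-integrable P
  (fun y => ((1 - cos (t * y)) * y `^ (- (1 + alpha)))%:E).
Proof.
move=> t0; apply/integrableP; split; first by apply: measurable_funTS; meas.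
rewrite (@eq_integral_gt0 _ _ (fun y => ((1 - cos (t * y)) * y `^ (- (1 + alpha)))%:E)).
  by rewrite integral_oneBcos// ltry.
by move=> y _; rewrite gee0_abs// lee_fin mulr_ge0 ?powR_ge0// subr_ge0 cos_le1.
Qed.

Let integral_mull (k : R) (q : R -> R) : leb.-integrable P (fun t => (q t)%:E) ->
  (\int[leb]_(t in P) (k * q t)%:E = k%:E * \int[leb]_(t in P) (q t)%:E)%E.
Proof. by move=> iq; rewrite -integralZl. Qed.

Let inner_t y : 0 < y -> (\int[leb]_(t in P) (F y t)%:E = (h y)%:E)%E.
Proof.
move=> y0; have it := h_integrand_integrable y.
rewrite /h /Rintegral EFinM fineK; last exact: (integrable_fin_num _ it).
rewrite -integral_mull//; apply: eq_integral_gt0 => t _.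
by rewrite /F; congr EFin; ring.
Qed.

Let inner_y t : 0 < t -> (\int[leb]_(y in P) (F y t)%:E =
  ((frac_const alpha)^-1 * (w t * t `^ alpha * cos (x * t + phi)))%:E)%E.
Proof.
have c0 := frac_const_gt0 alpha_gt0 alpha_lt2.
move=> t0; rewrite integral_mull; last exact: k_integrable.
rewrite integral_oneBcos// -EFinM; congr EFin.
by field; rewrite gt_eqF.
Qed.

Let F_fubini : leb.-integrable P (EFin \o h) /\
  \int[leb]_(y in P) h y =
  (frac_const alpha)^-1 * \int[leb]_(t in P) (w t * t `^ alpha * cos (x * t + phi)).
Proof.
have c0 := frac_const_gt0 alpha_gt0 alpha_lt2.
have mwa : measurable_fun setT (fun t : R => w t * t `^ alpha) by meas.
(* As 1 - cos is nonnegative, the absolute value falls on the factor in [t] alone. The [y]-integral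
   is again the symbol, so the assumption [iwa] on the weight times t^alpha gives finiteness. *)
have Fnorm : (\int[leb]_(t in P) \int[leb]_(y in P) `|(F y t)%:E| < +oo)%E.
  rewrite (@eq_integral_gt0 _ _ (fun t => `|(frac_const alpha)^-1 *
      (w t * t `^ alpha * cos (x * t + phi))|%:E)); last first.
    move=> t t0.
    rewrite (@eq_integral_gt0 _ _ (fun y => (`|w t * (2 * cos (x * t + phi))| *
       ((1 - cos (t * y)) * y `^ (- (1 + alpha))))%:E)); last first.
      move=> y y0; rewrite abse_EFin normrM [X in _ * X]ger0_norm//.
      by rewrite mulr_ge0 ?powR_ge0// subr_ge0 cos_le1.
    rewrite ge0_integral_mull//; last 2 first.
    - by meas.
    - by move=> y _; rewrite mulr_ge0 ?powR_ge0// subr_ge0 cos_le1.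
    rewrite integral_oneBcos// -EFinM; congr EFin.
    rewrite -[X in _ * X]ger0_norm; last by rewrite divr_ge0 ?powR_ge0// mulr_ge0// ltW.
    by rewrite -normrM; congr (`|_|); field; rewrite gt_eqF.
  have := integrable_mull (frac_const alpha)^-1 (integrable_mulr_cos x phi mwa iwa).
  by move=> /integrableP[_].
have [i1 e1] := @fubini_gt0 _ (fun p => (F p.1 p.2)%:E) mF Fnorm.
rewrite /= in e1; rewrite (eq_integral_gt0 inner_t) (eq_integral_gt0 inner_y) in e1.
split.
  move: i1; apply: eq_integrable => // y; rewrite mem_gt0 => y0.
  exact: inner_t.
rewrite -RintegralZl//; last exact: integrable_mulr_cos.
by rewrite /Rintegral e1.
Qed.

Let truncE e : 0 < e -> pv_trunc g e = \int[leb]_(y in `]e, +oo[) h y.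
Proof.
move=> e0; have ig := g_integrable e0.
have mg := measurable_int _ ig.
have ig1 : leb.-integrable `]e, +oo[%classic (EFin \o g).
  apply: (integrableS _ _ _ ig) => //; first exact: measurable_outside.
  by move=> y /=; rewrite in_itv/= andbT => ey; rewrite gtr0_norm// (lt_trans e0).
have ih1 : leb.-integrable `]e, +oo[%classic (EFin \o h).
  apply: (integrableS _ _ _ F_fubini.1) => // y /=.
  by rewrite !in_itv/= !andbT; exact: lt_trans.
have e_gt0 y : y \in (`]e, +oo[%classic : set R) -> 0 < y.
  by rewrite inE/= in_itv/= andbT; exact: lt_trans.
(* On this ray g(-y) is the difference of the integrable functions [h] and [g]. *)
have ig2 : leb.-integrable `]e, +oo[%classic (fun y => (g (- y))%:E).
  have ihg : leb.-integrable `]e, +oo[%classic ((EFin \o h) \- (EFin \o g))%E.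
    exact: integrableB.
  move: ihg; apply: eq_integrable => // y /e_gt0 y0.
  by rewrite /= -EFinB -gh// addrAC subrr add0r.
rewrite /pv_trunc /Rintegral integral_outside// -integralD_EFin//.
congr fine; apply: eq_integral => y /e_gt0 y0.
by rewrite /= -EFinD gh.
Qed.

Let trunc_cvg : pv_trunc g e @[e --> 0^'+] --> (frac_const alpha)^-1 *
  \int[leb]_(t in P) (w t * t `^ alpha * cos (x * t + phi)).
Proof.
have [ih <-] := F_fubini.
apply: cvg_trans (cvg_Rintegral_tail ih); apply: near_eq_cvg.
near=> e; rewrite truncE//; near: e; exact: nbhs_right_gt.
Unshelve. all: by end_near. Qed.

Lemma pv_superposition :
  pv_exists (fun y => (f x - f (x + y)) / `|y| `^ (1 + alpha)) /\
  pv_integral (fun y => (f x - f (x + y)) / `|y| `^ (1 + alpha)) =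
  (frac_const alpha)^-1 *
  \int[leb]_(t in P) (w t * t `^ alpha * cos (x * t + phi)).
Proof.
split; last exact/cvg_lim/trunc_cvg.
by split; [exact: g_integrable|apply/cvg_ex; eexists; exact: trunc_cvg].
Qed.

End cosine_superposition.

Local Open Scope complex_scope.

(** * Laguerre weights and the hypergeometric sum *)

Section polar.
Context {R : realType}.
Local Notation C := R[i].
Implicit Types (p q x : R).

(* [(1 + i x) ^ (- p)], principal branch *)
Definition power_polar p x : C :=
  ((1 + x ^+ 2) `^ (- (p / 2)))%:C * (cos (p * atan x) -i* sin (p * atan x)).
Local Notation E := power_polar.

Let D0 x : 0 < 1 + x ^+ 2.
Proof. by rewrite ltr_pwDl// sqr_ge0. Qed.

Lemma power_polarD p q x : E (p + q) x = E p x * E q x.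
Proof.
rewrite /power_polar mulrACA -rmorphM/= -powRD ?(gt_eqF (D0 x)) ?implybT//.
rewrite -opprD -mulrDl; congr (_ * _).
by simpc; rewrite mulrDl cosD sinD opprD addrC -!mulrN; congr (_ +i* _); ring.
Qed.

Lemma sqrt_oneDsqr x : (1 + x ^+ 2) `^ (- (1 / 2)) = cos (atan x).
Proof. by rewrite cos_atan powRN mul1r powR12_sqrt// ltW. Qed.

Lemma power_polar1 x : E 1 x = ('i * x%:C + 1)^-1.
Proof.
have c0 : cos (atan x) != 0 by rewrite cos_atan invr_neq0// sqrtr_eq0 -ltNge.
have st : sin (atan x) = x * cos (atan x).
  by rewrite -{2}(atanK x) /tan mulfVK.
have c2 : cos (atan x) ^+ 2 * (1 + x ^+ 2) = 1.
  by rewrite cos_atan exprVn sqr_sqrtr ?(ltW (D0 x))// mulVf// gt_eqF.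
have s0 : 'i * x%:C + 1 != 0 :> C by simpc; rewrite eq_complex/= oner_eq0.
apply: (mulIf s0); rewrite mulVf// /power_polar sqrt_oneDsqr mul1r st.
simpc; apply/eqP; rewrite eq_complex/=; apply/andP; split; apply/eqP.
  by rewrite -c2; ring.
by ring.
Qed.

Let sE x : 'i * x%:C + 1 = 1 +i* x :> C.
Proof. by simpc. Qed.

(** The real part is positive, so the argument lies in ]-pi/2, pi/2[. The two cases follow the
    definition of [carg], where [acos] recovers only the absolute value of the angle. *)
Lemma carg_oneDi x : carg ('i * x%:C + 1) = atan x.
Proof.
have tp : - (pi / 2) < atan x < pi / 2 by rewrite atan_gtNpi2 atan_ltpi2.
have pi0 := @pi_gt0 R.
rewrite sE /carg /cabs /= expr1n div1r -cos_atan; case: ifPn => x0.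
  have : 0 <= atan x by rewrite -atan0 le_atan.
  by move=> a0; rewrite cosK// in_itv/=; lra.
have a0 : atan x < 0 by rewrite -[X in _ < X]atan0 lt_atan// ltNge.
by rewrite cosKN ?opprK//; lra.
Qed.

Lemma cpowV_oneDi p x : (cpow ('i * x%:C + 1) p%:C)^-1 = E p x.
Proof.
have -> : cpow ('i * x%:C + 1) p%:C = E (- p) x.
  rewrite /cpow /cLog carg_oneDi sE /cabs/= expr1n /power_polar /cexp.
  have -> : p%:C * (ln (Num.sqrt (1 + x ^+ 2)) +i* atan x) =
     (p * ln (Num.sqrt (1 + x ^+ 2))) +i* (p * atan x) by simpc.
  rewrite /= !mulNr cosN sinN !opprK; congr (_%:C * _).
  rewrite /powR (gt_eqF (D0 x)) -powR12_sqrt ?(ltW (D0 x))// ln_powR.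
  by congr expR; field.
have e : E p x * E (- p) x = 1.
  rewrite -power_polarD subrr /power_polar mul0r oppr0 powRr0 mul0r cos0 sin0.
  by rewrite oppr0 mul1r.
have nz : E (- p) x != 0.
  by apply: contra_eq_neq e => ->; rewrite mulr0 eq_sym oner_eq0.
by apply: (mulIf nz); rewrite e mulVf.
Qed.

Lemma power_polar_exp (k : nat) x : E k%:R x = ('i * x%:C + 1) ^- k.
Proof.
elim: k => [|k IH]; last first.
  by rewrite -addn1 natrD power_polarD IH power_polar1 exprD expr1 invfM.
rewrite expr0 invr1 /power_polar mul0r oppr0 powRr0 mul0r cos0 sin0.
by rewrite oppr0 mul1r.
Qed.

(** The Laplace transform of t^(p-1) at 1 + i x, split into components: cos (x t - pi/2) = sin (x
    t). *)
Lemma gamma_cos_power_polar p x : 0 < p ->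
  (Gamma p)%:C * E p x = gamma_cos p 0 x -i* gamma_cos p (- (pi / 2)) x.
Proof.
move=> p0; rewrite !gamma_cosE// addr0 cosBpihalf /power_polar.
by simpc; apply/eqP; rewrite eq_complex/=; apply/andP; split; apply/eqP; ring.
Qed.

Lemma power_polarN p x : E p (- x) = (E p x)^*.
Proof.
rewrite /power_polar sqrrN atanN mulrN cosN sinN opprK.
by simpc.
Qed.

End polar.

Section laguerre.
Context {R : realType}.
Local Notation C := R[i].
Local Notation leb := (@lebesgue_measure R).
Local Notation P := (`]0, +oo[%classic : set R).
Variable m : nat.

(** The coefficients of L_m(2t), with L_m the Laguerre polynomial; [laguerre_weight] is e^(-t)
    L_m(2t). *)
Definition laguerre_coef (k : nat) : R := 'C(m, k)%:R * (- 2) ^+ k / k`!%:R.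
Local Notation a := laguerre_coef.

(* [mu_fun m] is the Laplace transform of this weight along [1 + i x]. *)
Definition laguerre_weight (t : R) : R :=
  \sum_(k < m.+1) a k * (t `^ k%:R * expR (- t)).
Local Notation w := laguerre_weight.

Lemma integral_sum_gt0 (n : nat) (F : nat -> R -> R) :
  (forall k, leb.-integrable P (fun t => (F k t)%:E)) ->
  leb.-integrable P (fun t => (\sum_(k < n) F k t)%:E) /\
  \int[leb]_(t in P) \sum_(k < n) F k t = \sum_(k < n) \int[leb]_(t in P) F k t.
Proof.
move=> iF; elim: n => [|n [IH1 IH2]].
  have F0 : (fun t => \sum_(k < 0) F k t) = cst 0 by apply/funext => t; rewrite big_ord0.
  split; last by rewrite F0 big_ord0 /Rintegral integral0.
  have := integrable_mull 0 (iF 0%N); apply: eq_integrable => // t _.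
  by rewrite big_ord0 mul0r.
split.
  have := integrable_add IH1 (iF n); apply: eq_integrable => // t _.
  by rewrite big_ord_recr.
rewrite big_ord_recr/= -IH2 -RintegralD//; last exact: iF.
by apply: eq_Rintegral => t _; rewrite big_ord_recr.
Qed.

Lemma measurable_laguerre_weight : measurable_fun setT w.
Proof.
apply: measurable_sum => k; meas.
Qed.

Lemma laguerre_weightE q t : 0 < t -> 0 <= q ->
  w t * t `^ q = \sum_(k < m.+1) a k * (t `^ (k%:R + 1 + q - 1) * expR (- t)).
Proof.
move=> t0 q0; rewrite /w mulr_suml; apply: eq_bigr => k _.
have -> : k%:R + 1 + q - 1 = k%:R + q :> R by ring.
by rewrite powRD ?(gt_eqF t0) ?implybT//; ring.
Qed.

Lemma integrable_laguerre_weight q : 0 <= q ->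
  leb.-integrable P (fun t => (w t * t `^ q)%:E).
Proof.
move=> q0.
have ik k : leb.-integrable P
    (fun t => (a k * (t `^ (k%:R + 1 + q - 1) * expR (- t)))%:E).
  apply: integrable_mull; apply: gamma_integrable.
  by rewrite ltr_wpDr// ltr_wpDl.
have [+ _] := integral_sum_gt0 m.+1 ik; apply: eq_integrable => // t.
by rewrite mem_gt0 => t0; rewrite laguerre_weightE.
Qed.

Lemma integral_laguerre_weight q phi x : 0 <= q ->
  \int[leb]_(t in P) (w t * t `^ q * cos (x * t + phi)) =
  \sum_(k < m.+1) a k * gamma_cos (k%:R + 1 + q) phi x.
Proof.
move=> q0.
have p0 (k : nat) : 0 < k%:R + 1 + q by rewrite ltr_wpDr// ltr_wpDl.
have ik k : leb.-integrable P (fun t => (t `^ (k%:R + 1 + q - 1) * expR (- t) *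
      cos (x * t + phi))%:E).
  by apply: integrable_mulr_cos; [meas|exact: gamma_integrable].
have [_ e] := integral_sum_gt0 m.+1 (fun k => integrable_mull (a k) (ik k)).
transitivity (\sum_(k < m.+1) \int[leb]_(t in P)
  (a k * (t `^ (k%:R + 1 + q - 1) * expR (- t) * cos (x * t + phi)))).
  rewrite -e; apply: eq_Rintegral => t; rewrite mem_gt0 => t0.
  by rewrite laguerre_weightE// mulr_suml; apply: eq_bigr => k _; ring.
by apply: eq_bigr => k _; rewrite RintegralZl//; exact: ik.
Qed.

(** One family for both sides of the theorem: [q = 0] gives the function of index [m], and
    [q = alpha] its fractional Laplacian. *)
Definition laguerre_sum q x : C :=
  \sum_(k < m.+1) (a k * Gamma (k%:R + 1 + q))%:C * power_polar (k%:R + 1 + q) x.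

Let sum_complex (I : Type) (r : seq I) (u v : I -> R) :
  \sum_(k <- r) (u k +i* v k) = (\sum_(k <- r) u k) +i* (\sum_(k <- r) v k).
Proof.
elim: r => [|k r IH]; first by rewrite !big_nil.
by rewrite !big_cons IH; simpc.
Qed.

Let J q phi x := \int[leb]_(t in P) (w t * t `^ q * cos (x * t + phi)).

Lemma laguerre_sumE q x : 0 <= q ->
  laguerre_sum q x = J q 0 x -i* J q (- (pi / 2)) x.
Proof.
move=> q0; rewrite /J !integral_laguerre_weight// /laguerre_sum -sumrN -sum_complex.
apply: eq_bigr => k _; rewrite rmorphM/= -mulrA gamma_cos_power_polar; last first.
  by rewrite ltr_wpDr// ltr_wpDl.
by simpc.
Qed.

Lemma laguerre_sumN q x : laguerre_sum q (- x) = (laguerre_sum q x)^*.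
Proof.
rewrite /laguerre_sum rmorph_sum; apply: eq_bigr => k _.
by rewrite power_polarN [RHS]rmorphM; congr (_ * _); exact/esym/conjc_real.
Qed.

Let frac_component alpha (b phi x : R) (f : R -> R) : 0 < alpha -> alpha < 2 ->
  (forall x, f x = b * J 0 phi x) ->
  pv_exists (fun y => (f x - f (x + y)) / `|y| `^ (1 + alpha)) /\
  pv_integral (fun y => (f x - f (x + y)) / `|y| `^ (1 + alpha)) =
  (frac_const alpha)^-1 * (b * J alpha phi x).
Proof.
move=> a0 a2 fE.
have iw q : 0 <= q -> leb.-integrable P (fun t => (b * w t * t `^ q)%:E).
  move=> q0; have := integrable_mull b (integrable_laguerre_weight q0).
  by apply: eq_integrable => // t _; rewrite mulrA.
have iw0 : leb.-integrable P (EFin \o (fun t => b * w t)).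
  by have := iw 0 (lexx 0); apply: eq_integrable => // t _; rewrite powRr0 mulr1.
have mwq q : measurable_fun setT (fun t : R => w t * t `^ q).
  by meas; exact: measurable_laguerre_weight.
have JE q z : 0 <= q -> b * J q phi z =
    \int[leb]_(t in P) (b * w t * t `^ q * cos (z * t + phi)).
  move=> q0; rewrite -RintegralZl//.
    by apply: eq_Rintegral => t _; rewrite !mulrA.
  exact: (integrable_mulr_cos _ _ (mwq q) (integrable_laguerre_weight q0)).
have -> : f = superposition (fun t => b * w t) phi.
  apply/funext => z; rewrite fE JE//; apply: eq_Rintegral => t _.
  by rewrite powRr0 mulr1.
rewrite JE ?ltW//; apply: pv_superposition => //.
- by meas; exact: measurable_laguerre_weight.
- by apply: iw; rewrite ltW.
Qed.

(** The constants are signs: (1, -1) for nonnegative index, and (-1, -1) for negative index, where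
    the function is minus the conjugate of one of nonnegative index. *)
Lemma frac_laplacian_laguerre alpha (b1 b2 x : R) (u : R -> C) :
  0 < alpha -> alpha < 2 ->
  (forall x, u x = (b1 * J 0 0 x) +i* (b2 * J 0 (- (pi / 2)) x)) ->
  frac_laplacian_exists alpha u x /\
  frac_laplacian alpha u x =
    (b1 * J alpha 0 x) +i* (b2 * J alpha (- (pi / 2)) x).
Proof.
move=> a0 a2 uE; have c0 := frac_const_gt0 a0 a2.
have [e1 p1] := @frac_component alpha b1 0 x (fun z => complex.Re (u z)) a0 a2
  (fun z => congr1 (fun c : C => complex.Re c) (uE z)).
have [e2 p2] := @frac_component alpha b2 (- (pi / 2)) x (fun z => complex.Im (u z)) a0 a2
  (fun z => congr1 (fun c : C => complex.Im c) (uE z)).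
have divE (z : C) (r : R) : z / r%:C = (complex.Re z / r) +i* (complex.Im z / r).
  by case: z => z1 z2; rewrite -fmorphV/=; simpc.
have reE : (fun y => complex.Re (frac_integrand alpha u x y)) =
    (fun y => (complex.Re (u x) - complex.Re (u (x + y))) / `|y| `^ (1 + alpha)).
  apply/funext => y; rewrite /frac_integrand divE/=.
  by case: (u x) (u (x + y)) => [? ?] [].
have imE : (fun y => complex.Im (frac_integrand alpha u x y)) =
    (fun y => (complex.Im (u x) - complex.Im (u (x + y))) / `|y| `^ (1 + alpha)).
  apply/funext => y; rewrite /frac_integrand divE/=.
  by case: (u x) (u (x + y)) => [? ?] [].
rewrite /frac_laplacian_exists /frac_laplacian reE imE p1 p2; split; first by [].
by simpc; rewrite !mulVKf ?gt_eqF.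
Qed.

End laguerre.

Section hypergeometric.
Context {R : realType}.
Local Notation C := R[i].

Lemma pochhammerS (z : C) (k : nat) :
  pochhammer z k.+1 = pochhammer z k * (z + k%:R).
Proof. by rewrite /pochhammer big_ord_recr. Qed.

Lemma pochhammer0 (z : C) : pochhammer z 0 = 1.
Proof. by rewrite /pochhammer big_ord0. Qed.

Lemma pochhammer1 (k : nat) : pochhammer (1 : C) k = k`!%:R.
Proof.
elim: k => [|k IH]; first by rewrite pochhammer0.
by rewrite pochhammerS IH factS natrM -[in RHS]addn1 natrD mulrC addrC.
Qed.

Lemma pochhammerN (m k : nat) :
  pochhammer (- m%:R : C) k = (-1) ^+ k * (m ^_ k)%:R.
Proof.
elim: k => [|k IH]; first by rewrite pochhammer0 mul1r.
rewrite pochhammerS IH ffactnSr natrM exprS.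
have [km|mk] := leqP k m; first by rewrite natrB//; ring.
by rewrite ffact_small// !mulr0 !mul0r mulr0.
Qed.

Lemma Gamma_pochhammer (s : R) (k : nat) : 0 < s ->
  (Gamma s)%:C * pochhammer s%:C k = (Gamma (k%:R + s))%:C.
Proof.
move=> s0; elim: k => [|k IH]; first by rewrite pochhammer0 mulr1 add0r.
rewrite pochhammerS mulrA IH -addn1 natrD addrAC Gamma_succ; last by rewrite ltr_wpDl.
by rewrite -(rmorph_nat (real_complex R) k) -rmorphD -rmorphM/= mulrC (addrC s).
Qed.

Lemma Gamma_fact (k : nat) : Gamma (k%:R + 1) = k`!%:R :> R.
Proof.
elim: k => [|k IH]; first by rewrite add0r Gamma1.
by rewrite factS natrM -natr1 Gamma_succ ?IH// ltr_wpDl.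
Qed.

(** Termwise, with s = 1 + i x: (-m)_k / (1)_k = (-1)^k C(m,k), Gamma(1+alpha) (1+alpha)_k =
    Gamma(k+1+alpha), and (2/s)^k s^-(1+alpha) = 2^k s^-(k+1+alpha). The factor 1/k! of the series
    is the one in [laguerre_coef]. *)
Lemma hyp2F1_laguerre (alpha x : R) (m : nat) : 0 < alpha ->
  (Gamma (1 + alpha))%:C / cpow ('i * x%:C + 1) (1 + alpha%:C) *
  hyp2F1 (- m%:R) (1 + alpha%:C) 1 (2 / ('i * x%:C + 1)) =
  laguerre_sum m alpha x.
Proof.
move=> a0; have a1 : 0 < 1 + alpha by rewrite addr_gt0.
have -> : 1 + alpha%:C = (1 + alpha)%:C :> C by rewrite rmorphD.
rewrite cpowV_oneDi hyp2F1_terminating big_distrr/=; apply: eq_bigr => k _.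
rewrite /hyp2F1_term pochhammer1 pochhammerN -bin_ffact natrM.
have aE : (laguerre_coef m k)%:C = 'C(m, k)%:R * ((-1) ^+ k * 2 ^+ k) / k`!%:R :> C.
  rewrite /laguerre_coef exprNn [LHS]rmorphM fmorphV; congr (_ * _^-1); last exact: rmorph_nat.
  rewrite [LHS]rmorphM; congr (_ * _); first exact: rmorph_nat.
  by rewrite [LHS]rmorphM !rmorphXn rmorphN rmorph1 rmorph_nat.
have cM (u v : R) : (u * v)%:C = u%:C * v%:C by exact: rmorphM.
rewrite cM aE.
rewrite -(addrA k%:R) (power_polarD k%:R (1 + alpha)) power_polar_exp.
rewrite -(@Gamma_pochhammer (1 + alpha) k a1) expr_div_n.
have kf : (k`!%:R : C) != 0 by rewrite pnatr_eq0 -lt0n fact_gt0.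
have alg (f G p S T V b E : C) : f != 0 -> G * E * (S * (b * f) * p / f * (T * V / f)) =
    b * (S * T) / f * (G * p) * (V * E) by move=> f0; field.
exact: alg.
Qed.

(** At [q = 0] the factor Gamma(k+1) = k! cancels the denominator of [laguerre_coef], and what
    remains is the binomial expansion of (s - 2)^m / s^(m+1). *)
Lemma mu_fun_laguerre (m : nat) (x : R) : mu_fun m x = laguerre_sum m 0 x.
Proof.
have s0 : 'i * x%:C + 1 != 0 :> C by simpc; rewrite eq_complex/= oner_eq0.
rewrite /mu_fun /laguerre_sum; move: s0.
have -> : 'i * x%:C - 1 = ('i * x%:C + 1) - 2 :> C by ring.
under eq_bigr => k _.
  have -> : laguerre_coef m k * Gamma (k%:R + 1 + 0) = 'C(m, k)%:R * (- 2) ^+ k :> R.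
    by rewrite addr0 Gamma_fact /laguerre_coef mulfVK.
  rewrite addr0 natr1 power_polar_exp.
  have -> : ('C(m, k)%:R * (- 2) ^+ k)%:C = 'C(m, k)%:R * (- 2) ^+ k :> C.
    by rewrite rmorphM rmorphXn rmorphN !rmorph_nat.
  over.
move: ('i * x%:C + 1) => s s0.
have -> : s ^ (m%:Z + 1) = s ^+ m.+1 by rewrite -addn1.
rewrite -exprnP exprDn mulr_suml; apply: eq_bigr => k _.
have km : (k <= m)%N by rewrite -ltnS.
have -> : s ^+ m.+1 = s ^+ (m - k) * s ^+ k.+1 by rewrite -exprD addnS subnK.
rewrite -mulr_natl; move: (expf_neq0 (m - k) s0) (expf_neq0 k.+1 s0).
by move: (s ^+ (m - k)) (s ^+ k.+1) => A B A0 B0; field; rewrite A0 B0.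
Qed.

(** [Negz m] is -1-m. Replacing [x] by [- x] exchanges the two linear factors up to sign, and the
    2m+1 signs leave one minus. *)
Lemma mu_funN (m : nat) (x : R) : mu_fun (Negz m) x = - mu_fun m (- x).
Proof.
rewrite /mu_fun.
have -> : 'i * (- x)%:C - 1 = - ('i * x%:C + 1) :> C by rewrite rmorphN; ring.
have -> : 'i * (- x)%:C + 1 = - ('i * x%:C - 1) :> C by rewrite rmorphN; ring.
have -> : Negz m + 1 = - m%:Z by rewrite NegzE -addn1 PoszD opprD addrNK.
have -> : m%:Z + 1 = m.+1 by rewrite -addn1.
move: ('i * x%:C + 1) ('i * x%:C - 1) => r s.
have -> : r ^ (- m%:Z) = (r ^+ m)^-1 by case: (m) => [|m'] //; rewrite expr0 invr1.
have -> : s ^ Negz m = (s ^+ m.+1)^-1 by [].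
rewrite invrK -!exprnP (exprNn r) (exprNn s) (invfM ((-1) ^+ m.+1)) (exprS (-1)).
have := signr_eq0 C m; move: ((-1) ^+ m) (r ^+ m) ((s ^+ m.+1)^-1) => S A B S0.
by field; rewrite S0.
Qed.

End hypergeometric.

Theorem proposition3p1 (R : realType) (alpha : R)
    (alpha_gt0 : 0 < alpha) (alpha_lt2 : alpha < 2) :
  (forall (n : int) (x : R),
     frac_laplacian_exists alpha (mu_fun n) x /\
     frac_laplacian alpha (mu_fun n) x =
       if 0 <= n then
         (Gamma (1 + alpha))%:C
           / cpow ('i%C * x%:C + 1) (1 + alpha%:C)
         * hyp2F1 (- n%:~R) (1 + alpha%:C) 1 (2 / ('i%C * x%:C + 1))
       else
         - ((Gamma (1 + alpha))%:C
              / cpow (- 'i%C * x%:C + 1) (1 + alpha%:C))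
         * hyp2F1 (1 + n%:~R) (1 + alpha%:C) 1 (2 / (- 'i%C * x%:C + 1)))
  /\
  (forall x : R,
     frac_laplacian alpha (mu_fun 0) x =
       (Gamma (1 + alpha))%:C / cpow ('i%C * x%:C + 1) (1 + alpha%:C)).
Proof.
have nonneg (m : nat) (x : R) : frac_laplacian_exists alpha (mu_fun m) x /\
    frac_laplacian alpha (mu_fun m) x = laguerre_sum m alpha x.
  rewrite (laguerre_sumE m x (ltW alpha_gt0)) -mulN1r -[X in X +i* _]mul1r.
  apply: frac_laplacian_laguerre => // z.
  by rewrite mu_fun_laguerre laguerre_sumE// mul1r mulN1r.
(* By [laguerre_sumN] reflection in [x] is conjugation, so the function of index [Negz m] has, up to
   signs, the same components as that of index [m]. *)
have neg (m : nat) (x : R) : frac_laplacian_exists alpha (mu_fun (Negz m)) x /\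
    frac_laplacian alpha (mu_fun (Negz m)) x = - laguerre_sum m alpha (- x).
  have conjN (u v : R) : - (u -i* v)^* = (- 1 * u) +i* (- 1 * v).
    by rewrite !mulN1r; simpc.
  rewrite laguerre_sumN (laguerre_sumE m x (ltW alpha_gt0)) conjN.
  apply: frac_laplacian_laguerre => // z.
  by rewrite mu_funN mu_fun_laguerre laguerre_sumN laguerre_sumE// conjN.
have main : forall (n : int) (x : R), frac_laplacian_exists alpha (mu_fun n) x /\
    frac_laplacian alpha (mu_fun n) x =
    if 0 <= n then
      (Gamma (1 + alpha))%:C
        / cpow ('i%C * x%:C + 1) (1 + alpha%:C)
      * hyp2F1 (- n%:~R) (1 + alpha%:C) 1 (2 / ('i%C * x%:C + 1))
    else
      - ((Gamma (1 + alpha))%:C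
           / cpow (- 'i%C * x%:C + 1) (1 + alpha%:C))
      * hyp2F1 (1 + n%:~R) (1 + alpha%:C) 1 (2 / (- 'i%C * x%:C + 1)).
  case=> m x; first by have := nonneg m x; rewrite -(hyp2F1_laguerre x m alpha_gt0).
  (* The first hypergeometric parameter is thus [- m%:R] in both branches, and the series
     terminates. *)
  have -> : 1 + (Negz m)%:~R = - m%:R :> R[i].
    by rewrite NegzE mulrNz -[_%:~R]/(m.+1%:R) -addn1 natrD opprD addrCA subrr addr0.
  have -> : - 'i * x%:C + 1 = 'i * (- x)%:C + 1 :> R[i].
    by rewrite rmorphN mulrN mulNr.
  have := neg m x; rewrite -(hyp2F1_laguerre (- x) m alpha_gt0).
  by rewrite mulNr.
split=> // x; have [_ ->] := main 0 x.
(* For [n = 0] the terminating sum consists of the term [k = 0], which is 1. *)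
rewrite lexx (hyp2F1_terminating 0) big_ord1 /hyp2F1_term !pochhammer0.
by rewrite expr0 fact0 !mulr1 !invr1 !mulr1.
Qed.
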